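(* Let $F,G\in\mathcal{F}(\mathbb{R})$ and let $W$ be a weight function system. Let $E$ be a locally complete locally convex Hausdorff space with a fundamental sequence of bounded sets. If the $E$-valued Cauchy–Riemann operator $\overline\partial:\mathcal{K}_W(T^{F,G};E)\to\mathcal{K}_W(T^{F,G};E)$ is surjective, then $E$ satisfies $(A)$.
   Context: $\overline\partial=\frac12\left(\frac{\partial}{\partial x}+i\frac{\partial}{\partial y}\right)$. $\mathcal{F}(\mathbb{R})$ is the set of all uniformly continuous $F:\mathbb{R}\to[0,\infty)$ with $0<\inf_{t}F(t)\le\sup_{t}F(t)<\infty$. For $F,G\in\mathcal{F}(\mathbb{R})$, $T^{F,G}=\{z\in\mathbb{C}: -G(\mathrm{Re}\,z)<\mathrm{Im}\,z<F(\mathrm{Re}\,z)\}$. A weight function is a non-decreasing unbounded function $w:[0,\infty)\to[0,\infty)$; a weight function system is a sequence $W=(w_N)_{N\in\mathbb{N}}$ of weight functions with $w_N\le w_{N+1}$ pointwise. For a locally convex Hausdorff space $E$, $\mathcal{K}_W(T^{F,G};E)$ is the space of all $\mathbf{f}\in C^\infty(T^{F,G};E)$ such that $\sup_{\xi\in\overline{T^{aF,aG}}}e^{w_N(|\mathrm{Re}\,\xi|)}p(\mathbf{f}^{(\alpha)}(\xi))<\infty$ for all continuous seminorms $p$ on $E$, all $N\in\mathbb{N}$, all multi-indices $\alpha$ (pairs of non-negative integers) and all $a\in(0,1)$. $E$ is locally complete if every bounded subset is contained in a Banach disk, i.e. an absolutely convex bounded set $B$ whose span, normed by the Minkowski functional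 of $B$, is complete. A space $E$ with a fundamental non-decreasing sequence $(B_n)_n$ of absolutely convex bounded sets (every bounded set is contained in some $B_n$) satisfies $(A)$ if $\exists n\,\forall m\ge n, s>0\,\exists k\ge m, C>0\,\forall r>0:\ B_m\subseteq rB_n+\frac{C}{r^s}B_k$. *)

(* Defs.v *)
From mathcomp Require Import all_boot all_order all_algebra.
From mathcomp Require Import complex.
From mathcomp Require Import all_classical all_reals all_analysis.

Set Implicit Arguments.
Unset Strict Implicit.
Unset Printing Implicit Defensive.

Import Order.TTheory GRing.Theory Num.Theory.
Import numFieldNormedType.Exports.
Import Normc.

Local Open Scope classical_set_scope.
Local Open Scope complex_scope.
Local Open Scope ring_scope.

(* The regular algebra R[i]^o is the carrier on which the library puts the
   norm topology of the complex plane. *)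
Notation Cplane R := (R[i]^o).

Section Strip.
Variable R : realType.

Definition calF (F : R -> R) : Prop :=
  [/\ unif_continuous F, (forall t, 0 <= F t),
      (0 < ereal_inf [set (F t)%:E | t in setT])%E &
      (ereal_sup [set (F t)%:E | t in setT] < +oo)%E].

Definition strip (F G : R -> R) : set (Cplane R) :=
  [set z | - G (complex.Re z) < complex.Im z < F (complex.Re z)].

(* Only the restriction of w to [0, +oo[ is meaningful. *)
Definition weight (w : R -> R) : Prop :=
  [/\ (forall t, 0 <= t -> 0 <= w t),
      (forall s t, 0 <= s -> s <= t -> w s <= w t) &
      (forall M, exists2 t, 0 <= t & M < w t)].

Definition weight_system (W : nat -> R -> R) : Prop :=
  (forall N, weight (W N)) /\
  (forall N t, 0 <= t -> W N t <= W N.+1 t).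

End Strip.

Section LocallyConvex.
Variables (R : realType) (E : tvsType R[i]).

Definition seminorm (p : E -> R) : Prop :=
  (forall x y, p (x + y) <= p x + p y) /\
  (forall (c : R[i]) x, p (c *: x) = normc c * p x).

Definition absolutely_convex (B : set E) : Prop :=
  forall x y (a b : R[i]), B x -> B y -> normc a + normc b <= 1 ->
    B (a *: x + b *: y).

Definition tvs_bounded (B : set E) : Prop :=
  forall U : set E, nbhs 0 U -> exists2 s : R, 0 < s &
    forall t : R, s < t -> B `<=` [set t%:C *: y | y in U].

Definition lspan (B : set E) : set E :=
  [set x | exists n (c : 'I_n -> R[i]) (v : 'I_n -> E),
     (forall i, B (v i)) /\ x = \sum_(i < n) c i *: v i].

Definition minkowski_functional (B : set E) (x : E) : R :=
  inf [set t : R | 0 < t /\ exists2 y, B y & x = t%:C *: y].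

Definition span_complete (B : set E) : Prop :=
  forall u : nat -> E, (forall n, lspan B (u n)) ->
    (forall e : R, 0 < e -> exists N, forall m n, (N <= m)%N -> (N <= n)%N ->
      minkowski_functional B (u m - u n) < e) ->
    exists2 l, lspan B l &
      forall e : R, 0 < e -> exists N, forall n, (N <= n)%N ->
        minkowski_functional B (u n - l) < e.

(* For B bounded and E Hausdorff the Minkowski functional is a norm on the
   span of B, so only completeness has to be required. *)
Definition banach_disk (B : set E) : Prop :=
  [/\ absolutely_convex B, tvs_bounded B & span_complete B].

Definition locally_complete : Prop :=
  forall A : set E, tvs_bounded A -> exists2 B, banach_disk B & A `<=` B.

Definition fundamental_bounded_sequence (B : nat -> set E) : Prop :=
  [/\ (forall n, absolutely_convex (B n) /\ tvs_bounded (B n)),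
      (forall n, B n `<=` B n.+1) &
      (forall A, tvs_bounded A -> exists n, A `<=` B n)].

Definition condition_A (B : nat -> set E) : Prop :=
  exists n, forall (m : nat) (s : R), (n <= m)%N -> 0 < s ->
    exists (k : nat) (C : R), [/\ (m <= k)%N, 0 < C &
      forall r : R, 0 < r ->
        B m `<=` [set r%:C *: x + (C / r `^ s)%:C *: y | x in B n & y in B k]].

End LocallyConvex.

Section VectorValued.
Variables (R : realType) (E : tvsType R[i]).
Implicit Types (f : Cplane R -> E) (z v : Cplane R) (A : set (Cplane R)).

(* [derive] of the library takes the increment in the scalar field of the
   target, here R[i], and normed spaces only; partial derivatives use a real
   increment. *)
Definition diff_quotient v f z (h : R) : E :=
  (h^-1)%:C *: (f (z + h%:C * v) - f z).

Definition is_rderive v f z (l : E) : Prop :=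
  diff_quotient v f z h @[h --> 0^'] --> l.

Definition rderivable v f z : Prop := exists l, is_rderive v f z l.

(* [lim] is not available because a tvsType is not a pointed type. *)
Definition rderive v f z : E := xget 0 [set l | is_rderive v f z l].

Definition dx f : Cplane R -> E := rderive 1 f.
Definition dy f : Cplane R -> E := rderive 'i%C f.

(* Functions on an open set A are represented by total functions, of which
   only the values on A matter. *)
Fixpoint Ck k A f : Prop :=
  (forall z, A z -> {for z, continuous f}) /\
  (if k is k'.+1 then
     [/\ (forall z, A z -> rderivable 1 f z /\ rderivable 'i%C f z),
         Ck k' A (dx f) & Ck k' A (dy f)]
   else True).

Definition Cinfty A f : Prop := forall k, Ck k A f.

Definition partial (alpha : nat * nat) f : Cplane R -> E :=
  iter alpha.1 dx (iter alpha.2 dy f).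

Definition dbar f : Cplane R -> E :=
  fun z => (2^-1 : R)%:C *: (dx f z + 'i%C *: dy f z).

Definition KW (W : nat -> R -> R) (F G : R -> R) : set (Cplane R -> E) :=
  [set f | Cinfty (strip F G) f /\
     forall p : E -> R, seminorm p -> continuous p ->
     forall (N : nat) (alpha : nat * nat) (a : R), 0 < a -> a < 1 ->
       (ereal_sup [set (expR (W N `|complex.Re xi|) * p (partial alpha f xi))%:E
          | xi in closure (strip (fun t => a * F t)%R (fun t => a * G t)%R)]
        < +oo)%E].

(* Equality in K_W(T^{F,G}; E) is equality on T^{F,G}. *)
Definition dbar_surjective (W : nat -> R -> R) (F G : R -> R) : Prop :=
  forall g, KW W F G g ->
    exists2 f, KW W F G f & forall z, strip F G z -> dbar f z = g z.

End VectorValued.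

(* Main.v *)
(* Suppose that (A) fails and put l = liminf F at +oo. For every n, with e_n a
   small multiple of l / (n + 1) and s = e_n / (4 l), there are a fixed B_m,
   arbitrarily large t and vectors x in B_m outside e^t B_n + e^(-s t) B_k, for
   any prescribed k. Attach such data to far apart centres X_i of the real axis,
   every n serving infinitely many i, and let g be the sum of the functions
   d_i u_i(z) x_i, where d_i is a small constant and u_i is, up to a constant, a
   bump of width 1 / lam_i (lam_i = t_i / l) located just below height l over
   X_i, divided by h_i = exp(lam_i (i w - c w^2)), w = z - X_i.

   Let f solve dbar f = g. It maps the real axis into some B_N, and a far right
   part of the strip 0 <= y <= l - 2 e_N into some B_K. Take i >= K belonging to
   n = N and integrate h_i dbar f over a rectangle of height l - 2 e_N over X_i.
   The result is a multiple of x_i. By Green's formula it is also a boundary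
   integral of h_i f, in which |h_i| <= 1 on the bottom side, where f lies in
   B_N, and |h_i| is tiny on the other three sides, where f lies in B_K. Hence
   x_i lies in e^t B_N + e^(-s t) B_i, a contradiction.

   Vector-valued integrals are avoided: on a q x q grid the telescoping sums of
   h_i f satisfy Green's formula up to O(1/q), which is enough. *)
Require Import Defs.
From mathcomp Require Import all_boot all_order all_algebra.
From mathcomp Require Import complex.
From mathcomp Require Import all_classical all_reals all_analysis.
From mathcomp Require Import ring lra.
Set Implicit Arguments.
Unset Strict Implicit.
Unset Printing Implicit Defensive.
Import Order.TTheory GRing.Theory Num.Theory.
Import numFieldNormedType.Exports.
Import Normc.
Local Open Scope classical_set_scope.
Local Open Scope complex_scope.
Local Open Scope ring_scope.

(** * Norm, limits and seminorms *)

(** The index N is known only after g is fixed, so a single g must obstruct every n at once, while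
    the sets B_m that contain the vectors are not controlled as n grows. Such a g can still lie in
    K_W, because each estimate there concerns a strip of ratio a < 1: e_n tends to 0 and the centres
    sit where F < l + e_n, so that strip meets the bumps of finitely many n only. Conversely, l
    being a lower limit, far to the right the strip contains all heights between 0 and l - e_N,
    which leaves room for rectangles of height l - 2 e_N.

    The linear part of the exponent makes |h_i| decay with height but does nothing on the vertical
    sides; the quadratic part is there for them. With c = 1 / (4 l) it contributes exactly l at
    distance 2 l from X_i, and the logarithmic decay in height stays at least lam_i / 2 up to height
    l. Hence the two units e_N from the bump (below l - 4 e_N) to the top side (l - 2 e_N) gain at
    least e_N in the exponent. One quarter of e_N pays for the width of the bump, another for d_i
    and powers of lam_i; of the rest only e_N / 4 is claimed, which is s t / lam_i. *)

Section Plane.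
Variable R : realType.
Implicit Types (z w v : Cplane R) (t : R).

Lemma normcE z : `|z| = (normc (z : R[i]))%:C.
Proof. by case: z => a b; rewrite normc_def. Qed.

Lemma normc_ge0 (z : R[i]) : 0 <= normc z.
Proof. by case: z => a b; rewrite /normc sqrtr_ge0. Qed.

Lemma normc_real t : normc t%:C = `|t|.
Proof. by rewrite /normc /= expr0n addr0 sqrtr_sqr. Qed.

Lemma normc_opp (z : R[i]) : normc (- z) = normc z.
Proof. by rewrite -mulN1r normcM -[X in normc X](rmorphN1 (real_complex R)) normc_real normrN1 mul1r. Qed.

Lemma normci : normc 'i%C = 1 :> R.
Proof. by rewrite /normc /= expr0n add0r expr1n sqrtr1. Qed.

Lemma ler_normcD (z w : R[i]) : normc (z + w) <= normc z + normc w.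
Proof. by rewrite -lecR rmorphD /= -!normcE ler_normD. Qed.

Lemma ler_Re_normc (z : R[i]) : `|complex.Re z| <= normc z.
Proof. by case: z => a b /=; rewrite -sqrtr_sqr ler_wsqrtr// lerDl sqr_ge0. Qed.

Lemma ler_Im_normc (z : R[i]) : `|complex.Im z| <= normc z.
Proof. by case: z => a b /=; rewrite -sqrtr_sqr ler_wsqrtr// lerDr sqr_ge0. Qed.

Lemma ler_normc_ReIm (z : R[i]) : normc z <= `|complex.Re z| + `|complex.Im z|.
Proof.
case: z => a b; rewrite [X in normc X](_ : _ = a%:C + 'i%C * b%:C); last first.
  by simpc.
by apply: (le_trans (ler_normcD _ _)); rewrite normcM normci mul1r !normc_real.
Qed.

Lemma nbhs_planeP z (A : set (Cplane R)) :
  nbhs z A <-> exists2 e : R, 0 < e & forall w, normc (w - z : R[i]) < e -> A w.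
Proof.
split.
  case/nbhs_ballP => e /= e0 eA.
  have eE : e = (complex.Re e)%:C.
    by rewrite RRe_real// gtr0_real.
  exists (complex.Re e); first by rewrite -ltcR -eE.
  by move=> w wz; apply: eA; rewrite -ball_normE /= distrC normcE eE ltcR.
case=> e e0 eA; apply/nbhs_ballP; exists e%:C => /=; first by rewrite ltcR.
by move=> w; rewrite -ball_normE /= distrC normcE ltcR; exact: eA.
Qed.

Lemma Re_continuous : continuous (@complex.Re R : Cplane R -> R).
Proof.
move=> z A /nbhs_ballP[e e0 eA]; apply/nbhs_planeP; exists e => // w wz.
apply: eA; rewrite -ball_normE /= distrC; apply: le_lt_trans wz.
by apply: le_trans (ler_Re_normc _); case: w z => ? ? [].
Qed.

Lemma Im_continuous : continuous (@complex.Im R : Cplane R -> R).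
Proof.
move=> z A /nbhs_ballP[e e0 eA]; apply/nbhs_planeP; exists e => // w wz.
apply: eA; rewrite -ball_normE /= distrC; apply: le_lt_trans wz.
by apply: le_trans (ler_Im_normc _); case: w z => ? ? [].
Qed.

Lemma real_complex_continuous : continuous (fun t : R => t%:C : Cplane R).
Proof.
move=> t A /nbhs_planeP[e e0 eA]; apply/nbhs_ballP; exists e => //= s.
rewrite -ball_normE /= distrC => st; apply: eA.
by rewrite -rmorphB normc_real.
Qed.

Lemma normc_continuous : continuous (fun z : Cplane R => normc (z : R[i])).
Proof.
move=> z A /nbhs_ballP[e e0 eA]; apply/nbhs_planeP; exists e => // w wz.
apply: eA; rewrite -ball_normE /=; apply: le_lt_trans wz.
have h (a b : R[i]) : normc a - normc b <= normc (b - a).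
  rewrite lerBlDl -[X in _ <= _ + X]normc_opp opprB.
  by apply: le_trans (ler_normcD _ _); rewrite addrC subrK.
rewrite ler_norml; apply/andP; split; last exact: h.
by rewrite lerNl opprB; apply: le_trans (h _ _) _; rewrite -normc_opp opprB.
Qed.

End Plane.

Section Limits.
Variables (R : realType) (E : tvsType R[i]).
Variables (T : Type) (F : set_system T).
Context {FF : Filter F}.

Lemma tvs_cvgD (f g : T -> E) (a b : E) :
  f @ F --> a -> g @ F --> b -> (fun t => f t + g t) @ F --> a + b.
Proof.
move=> fa gb; apply: (@cvg_comp _ _ _ (fun t => (f t, g t)) (fun x => x.1 + x.2) _ (nbhs (a, b))).
  exact: cvg_pair.
exact: (@add_continuous E (a, b)).
Qed.

Lemma tvs_cvgZ (c : T -> Cplane R) (f : T -> E) (c0 : Cplane R) (a : E) :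
  c @ F --> c0 -> f @ F --> a -> (fun t => (c t : R[i]) *: f t) @ F --> (c0 : R[i]) *: a.
Proof.
move=> cc fa; apply: (@cvg_comp _ _ _ (fun t => (c t, f t)) (fun x => x.1 *: x.2) _ (nbhs (c0, a))).
  exact: (cvg_pair cc fa).
exact: (@scale_continuous _ E (c0, a)).
Qed.

Lemma tvs_cvgN (f : T -> E) (a : E) :
  f @ F --> a -> (fun t => - f t) @ F --> - a.
Proof. by move=> fa; apply: (cvg_comp _ _ fa); exact: opp_continuous. Qed.

End Limits.

Section Seminorms.
Variables (R : realType) (E : tvsType R[i]).
Implicit Types (p : E -> R) (A B U V : set E).

Section Basic.
Variable p : E -> R.
Hypothesis sp : seminorm p.

Lemma seminorm0 : p 0 = 0.
Proof. by rewrite -(scale0r 0) sp.2 normc0 mul0r. Qed.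

Lemma seminormN x : p (- x) = p x.
Proof. by rewrite -scaleN1r sp.2 normc_opp normc1 mul1r. Qed.

Lemma seminormB x y : p (x - y) <= p x + p y.
Proof. by apply: le_trans (sp.1 _ _) _; rewrite seminormN. Qed.

Lemma seminorm_ge0 x : 0 <= p x.
Proof.
have := seminormB x x; rewrite subrr seminorm0 -mulr2n -mulr_natl.
by rewrite pmulr_rge0// ltr0n.
Qed.

Lemma seminormZ (t : R) x : p (t%:C *: x) = `|t| * p x.
Proof. by rewrite sp.2 normc_real. Qed.

Hypothesis cp : continuous p.

Lemma seminorm_near_lt (T : Type) (F : set_system T) (FF : Filter F)
    (f : T -> E) (a : E) (M : R) :
  f @ F --> a -> p a < M -> \forall t \near F, p (f t) < M.
Proof.
move=> fa paM; have := cvg_comp _ _ fa (@cp a).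
move=> /(_ [set s | s < M]); apply; exact: lt_nbhsl.
Qed.

Lemma seminorm_bounded B : tvs_bounded B ->
  exists2 M : R, 0 < M & forall x, B x -> p x <= M.
Proof.
move=> bB; have U0 : nbhs 0 [set x | p x < 1].
  by apply: (@seminorm_near_lt E (nbhs 0) _ id 0 1); [exact: cvg_id|rewrite seminorm0].
have [s s0 /(_ (s + 1))] := bB _ U0.
rewrite ltrDl ltr01 => /(_ isT) sB; exists (s + 1); first by rewrite addr_gt0.
move=> x /sB[y /= y1 <-]; rewrite seminormZ ger0_norm; last by rewrite addr_ge0// ltW.
by rewrite ler_piMr ?(ltW y1)// addr_ge0// ltW.
Qed.

End Basic.

(* [convex_set] only provides convex combinations; passing to the balanced core
   makes the gauge homogeneous for complex scalars. *)
Definition gauge_body V : set E :=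
  [set x | forall c : R[i], normc c <= 1 -> V (c *: x)].

(** Continuity of scaling at (0, 0) gives a radius [e] and a neighbourhood [A2] such that scalars
    below [e] send [A2] into [V]; the multiple of [A2] by [e / 2] then lies in the balanced core. *)
Lemma gauge_body_nbhs V : nbhs 0 V -> nbhs 0 (gauge_body V).
Proof.
move=> V0.
have := @scale_continuous _ E (0, 0); rewrite /continuous_at /= scaler0.
move=> /(_ V V0)[[A1 A2] /= [A10 A20] AV].
have [e e0 eA] := (nbhs_planeP 0 A1).1 A10.
pose d := e / 2; have d0 : 0 < d by rewrite divr_gt0.
have dC0 : d%:C != 0 :> R[i] by rewrite (fmorph_eq0 (real_complex R)) gt_eqF.
have : nbhs 0 ( *:%R (d%:C : R[i]) @` A2) by apply: nbhs0Z.
apply: filterS => x [y A2y <-] c c1; rewrite scalerA.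
apply: (AV (c * d%:C, y)); split => //=; apply: eA.
rewrite subr0 normcM normc_real gtr0_norm//.
apply: (@le_lt_trans _ _ d); first by rewrite ler_piMl// ltW.
by rewrite /d ltr_pdivrMr// mulr_natr mulr2n ltrDl.
Qed.

Lemma gauge_bodyZ V (c : R[i]) x : normc c <= 1 -> gauge_body V x -> gauge_body V (c *: x).
Proof.
move=> c1 Vx d d1; rewrite scalerA; apply: Vx.
by rewrite normcM mulr_ile1// normc_ge0.
Qed.

Lemma gauge_bodyD V x y (s t : R) : convex_set V ->
  0 <= s -> 0 <= t -> s + t = 1 ->
  gauge_body V x -> gauge_body V y -> gauge_body V (s%:C *: x + t%:C *: y).
Proof.
move=> cV s0 t0 st Vx Vy c c1; rewrite scalerDr !scalerA ![c * _]mulrC -!scalerA.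
have s0' : (0 : R[i]) <= s%:C by rewrite lecR.
have s1' : s%:C <= (1 : R[i]) by rewrite lecR -st lerDl.
have := @cV (c *: x) (c *: y) (Itv01 s0' s1'); rewrite !inE => /(_ (Vx c c1) (Vy c c1)).
rewrite /conv /=.
have -> : t%:C = 1 - s%:C :> R[i] by rewrite -(rmorph1 (real_complex R)) -rmorphB /= -st addrAC subrr add0r.
by [].
Qed.

Section Gauge.
Variable V : set E.
Hypotheses (V0 : nbhs 0 V) (cV : convex_set V).

Definition gauge x : R := inf [set t : R | 0 < t /\ gauge_body V ((t^-1)%:C *: x)].

Lemma gauge_body_le (s t : R) x : 0 < s -> s <= t ->
  gauge_body V ((s^-1)%:C *: x) -> gauge_body V ((t^-1)%:C *: x).
Proof.
move=> s0 st; have t0 := lt_le_trans s0 st.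
have -> : (t^-1)%:C *: x = (s / t)%:C *: ((s^-1)%:C *: x).
  by rewrite scalerA -rmorphM/= mulrAC divff ?gt_eqF// mul1r.
apply: gauge_bodyZ; rewrite normc_real ger0_norm; last by rewrite divr_ge0// ltW.
by rewrite ler_pdivrMr// mul1r.
Qed.

Lemma gauge_has_inf x : has_inf [set t : R | 0 < t /\ gauge_body V ((t^-1)%:C *: x)].
Proof.
split; last by exists 0 => t [/ltW].
have := @scale_continuous _ E (0, x); rewrite /continuous_at /= scale0r.
move=> /(_ _ (gauge_body_nbhs V0))[[A1 A2] /= [A10 A20] AV].
have [e e0 eA] := (nbhs_planeP 0 A1).1 A10.
exists (2 / e); split; first by rewrite divr_gt0.
apply: (AV ((2 / e)^-1%:C, x)); split => /=; last exact: nbhs_singleton.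
apply: eA; rewrite subr0 normc_real invf_div ger0_norm ?divr_ge0 ?ltW//.
by rewrite ltr_pdivrMr// mulr_natr mulr2n ltrDl.
Qed.

Lemma gauge_le x (t : R) : 0 < t -> gauge_body V ((t^-1)%:C *: x) -> gauge x <= t.
Proof. by move=> t0 Vt; apply: ge_inf; [exact: (gauge_has_inf x).2|]. Qed.

Lemma gauge_lt x (t : R) : gauge x < t -> 0 < t /\ gauge_body V ((t^-1)%:C *: x).
Proof.
move=> /(inf_lt (gauge_has_inf x).1)[s [s0 Vs] st].
by split; [exact: lt_trans st|exact: (gauge_body_le s0 (ltW st) Vs)].
Qed.

Lemma gauge_ge0 x : 0 <= gauge x.
Proof. by apply: lb_le_inf; [exact: (gauge_has_inf x).1|move=> t [/ltW]]. Qed.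

Lemma gaugeD x y : gauge (x + y) <= gauge x + gauge y.
Proof.
apply/ler_addgt0Pr => e e0.
have e2 : 0 < e / 2 by rewrite divr_gt0.
have [s0 Vs] := @gauge_lt x (gauge x + e / 2) (ltac:(by rewrite ltrDl)).
have [t0 Vt] := @gauge_lt y (gauge y + e / 2) (ltac:(by rewrite ltrDl)).
set s := gauge x + e / 2 in s0 Vs; set t := gauge y + e / 2 in t0 Vt.
have -> : gauge x + gauge y + e = s + t by rewrite /s /t; lra.
have st0 : 0 < s + t by rewrite addr_gt0.
apply: gauge_le => //.
have -> : (s + t)^-1%:C *: (x + y) =
    (s / (s + t))%:C *: ((s^-1)%:C *: x) + (t / (s + t))%:C *: ((t^-1)%:C *: y).
  rewrite !scalerA -!rmorphM/= scalerDr; congr (_%:C *: _ + _%:C *: _).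
    by rewrite mulrAC divff ?gt_eqF// mul1r.
  by rewrite mulrAC divff ?gt_eqF// mul1r.
apply: gauge_bodyD => //; rewrite ?divr_ge0 ?(ltW s0) ?(ltW t0) ?(ltW st0)//.
by rewrite -mulrDl divff// gt_eqF.
Qed.

Lemma gauge0 : gauge 0 = 0.
Proof.
apply/eqP; rewrite eq_le gauge_ge0 andbT; apply/ler_addgt0Pr => e e0.
rewrite add0r; apply: gauge_le => //; rewrite scaler0 => c _.
by rewrite scaler0; exact: nbhs_singleton V0.
Qed.

Lemma gaugeZ_le (c : R[i]) x : c != 0 -> gauge (c *: x) <= normc c * gauge x.
Proof.
move=> c0; have nc0 : 0 < normc c.
  rewrite lt_def normc_ge0 andbT; apply: contra c0 => /eqP.
  by move=> /eq0_normc ->.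
rewrite -ler_pdivrMl//; apply: lb_le_inf; first exact: (gauge_has_inf x).1.
move=> t [t0 Vt]; rewrite ler_pdivrMl//; apply: gauge_le; first exact: mulr_gt0.
have -> : ((normc c * t)^-1)%:C *: (c *: x) =
    (c * ((normc c)^-1)%:C) *: ((t^-1)%:C *: x).
  by rewrite !scalerA invfM rmorphM/=; congr (_ *: _); ring.
apply: gauge_bodyZ => //; rewrite normcM normc_real gtr0_norm ?invr_gt0//.
by rewrite divff// gt_eqF.
Qed.

Lemma gauge_seminorm : seminorm gauge.
Proof.
split=> [|c x]; first exact: gaugeD.
have [->|c0] := eqVneq c 0; first by rewrite scale0r gauge0 normc0 mul0r.
apply/eqP; rewrite eq_le gaugeZ_le//=.
have nc0 : 0 < normc c.
  rewrite lt_def normc_ge0 andbT; apply: contra c0 => /eqP.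
  by move=> /eq0_normc ->.
rewrite mulrC -ler_pdivlMr// mulrC -normcV.
have := @gaugeZ_le c^-1 (c *: x); rewrite invr_eq0 => /(_ c0).
by rewrite scalerA mulVf// scale1r.
Qed.

Lemma gauge_continuous : continuous gauge.
Proof.
move=> x; apply/cvgrPdist_le => e e0.
have h y z : gauge y - gauge z <= gauge (y - z).
  by rewrite lerBlDr; apply: le_trans (gaugeD _ _); rewrite subrK.
have gN y : gauge (- y) = gauge y by exact: seminormN gauge_seminorm y.
have : nbhs 0 ( *:%R (e%:C : R[i]) @` gauge_body V).
  by apply: nbhs0Z; [rewrite (fmorph_eq0 (real_complex R)) gt_eqF|exact: gauge_body_nbhs].
move=> /(nbhsT x); apply: filterS => _ [_ [y Vy <-] <-].
have ge : gauge (e%:C *: y) <= e.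
  apply: gauge_le => //; rewrite scalerA -rmorphM/= mulVf ?gt_eqF//.
  by rewrite scale1r.
rewrite ler_norml; apply/andP; split.
  by rewrite lerNl opprB; apply: le_trans (h _ _) _; rewrite addrC addrA addNr add0r.
by apply: le_trans (h _ _) _; rewrite opprD addrA subrr add0r gN.
Qed.

Lemma gauge_lt1 x : gauge x < 1 -> V x.
Proof.
move=> /gauge_lt[_ /(_ 1)]; rewrite invr1 !scale1r; apply.
by rewrite normc1.
Qed.

End Gauge.

(** By local convexity [U] contains a convex neighbourhood, and the gauge of its balanced core is a
    continuous seminorm to which the assumption applies. This is the bridge from the seminorm
    estimates of K_W to the sets of the fundamental sequence. *)
Lemma tvs_bounded_seminorm B :
  (forall p, seminorm p -> continuous p -> exists M, forall x, B x -> p x <= M) ->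
  tvs_bounded B.
Proof.
move=> hB U U0.
have [Bs Bconv [Bopen /(_ 0 U U0)[V [BV V0] VU]]] := @locally_convex _ E.
have cV : convex_set V by apply: Bconv; rewrite inE.
have V0' : nbhs 0 V by apply: open_nbhs_nbhs; split=> //; exact: Bopen.
have [M MB] := hB _ (gauge_seminorm V0' cV) (gauge_continuous V0' cV).
exists (`|M| + 1); first by rewrite ltr_wpDl.
move=> t Mt x Bx; have t0 : 0 < t by apply: le_lt_trans Mt; rewrite addr_ge0.
exists ((t^-1)%:C *: x); last first.
  by rewrite scalerA -rmorphM/= divff ?scale1r// gt_eqF.
apply: VU; apply: (gauge_lt1 V0').
rewrite (seminormZ (gauge_seminorm V0' cV)) gtr0_norm ?invr_gt0//.
rewrite ltr_pdivrMl// mulr1; apply: le_lt_trans (MB _ Bx) _.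
by apply: le_lt_trans (ler_norm _) _; apply: le_lt_trans Mt; rewrite lerDl.
Qed.

End Seminorms.

(** * Mean value inequality for seminorms *)

Section MeanValue.
Variables (R : realType) (E : tvsType R[i]) (p : E -> R).
Hypotheses (sp : seminorm p) (cp : continuous p).

(** Enlarging [M] to [M'] makes the bound on the derivative strict, hence valid for the increments
    on both sides of each point; these local bounds are chained from 0 to [T]. *)
Lemma seminorm_mvt (v v' : R -> E) (T M : R) : 0 <= T ->
  (forall t, 0 <= t <= T ->
    (h^-1)%:C *: (v (t + h) - v t) @[h --> 0^'] --> v' t) ->
  (forall t, 0 <= t <= T -> p (v' t) <= M) ->
  p (v T - v 0) <= M * T.
Proof.
move=> T0 dv Mv.
suff H : forall M', M < M' -> p (v T - v 0) <= M' * T.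
  have [->|Tn0] := eqVneq T 0; first by rewrite subrr seminorm0// mulr0.
  have Tp : 0 < T by rewrite lt_def Tn0.
  rewrite -ler_pdivrMr//; apply/ler_addgt0Pr => e e0.
  by rewrite ler_pdivrMr//; apply: H; rewrite ltrDl.
move=> M' MM'.
have loc t : 0 <= t <= T -> exists2 d : R, 0 < d &
    forall h, `|h| < d -> p (v (t + h) - v t) <= M' * `|h|.
  move=> tT; have := seminorm_near_lt cp _ (dv t tT) (le_lt_trans (Mv t tT) MM').
  move=> /(_ _)[d /= d0 dP]; exists d => // h hd.
  have [->|h0] := eqVneq h 0; first by rewrite addr0 subrr seminorm0// normr0 mulr0.
  have /= := dP h; rewrite sub0r normrN => /(_ hd h0).
  rewrite seminormZ// normfV mulrC ltr_pdivrMr ?normr_gt0// => /ltW //.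
(* Continuous induction: [sup S] belongs to [S], and cannot be less than [T]. *)
pose S := [set t | 0 <= t <= T /\ p (v t - v 0) <= M' * t].
have S0 : S 0 by split; [rewrite lexx|rewrite subrr seminorm0// mulr0].
have supS : has_sup S by split; [exists 0|exists T => t [/andP[]]].
have c0 : 0 <= sup S by apply: ub_le_sup => //; exact: supS.2.
have cT : sup S <= T by apply: ge_sup; [exists 0|move=> t [/andP[]]].
have tri a b c : p (v a - v c) <= p (v a - v b) + p (v b - v c).
  by apply: le_trans (sp.1 _ _); rewrite addrA subrK.
have [d d0 dP] := loc (sup S) (introT andP (conj c0 cT)).
have Sc : S (sup S).
  split; first by rewrite c0.
  have [t [/andP[t0 tT] pt] tc] := sup_adherent d0 supS.
  have ts : t <= sup S by apply: ub_le_sup; [exact: supS.2|split=> //; rewrite t0].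
  apply: le_trans (tri _ t _) _.
  have := dP (t - sup S); rewrite ler0_norm ?subr_le0// opprB.
  move=> dt.
  have {}dt : p (v t - v (sup S)) <= M' * (sup S - t).
    by move: dt; rewrite (_ : sup S + (t - sup S) = t); [apply; lra|lra].
  rewrite -(seminormN sp (v (sup S) - v t)) opprB; lra.
have [<-//|Tc] := eqVneq (sup S) T; first exact: Sc.2.
have cT' : sup S < T by rewrite lt_def eq_sym Tc.
pose h := Num.min (d / 2) (T - sup S).
have h0 : 0 < h by rewrite lt_min divr_gt0//= subr_gt0.
have hd : h < d by rewrite (@le_lt_trans _ _ (d / 2))// ?ge_min ?lexx//; lra.
have hT : sup S + h <= T by rewrite addrC -lerBrDr ge_min lexx orbT.
have : S (sup S + h).
  split; first by rewrite hT addr_ge0// ltW.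
  apply: le_trans (tri _ (sup S) _) _.
  by have := dP h; rewrite gtr0_norm// => /(_ hd); have := Sc.2; lra.
by move=> /(ub_le_sup supS.2); rewrite gerDl leNgt h0.
Qed.

(** Two applications of the mean value inequality: to [g] along the segment, then to [f] minus its
    linear part. This loses the factor 1/2 of Taylor's formula, which is harmless here. *)
Lemma seminorm_taylor (f g k : Cplane R -> E) (z u : Cplane R) (T M : R) : 0 <= T ->
  (forall t, 0 <= t <= T -> is_rderive u f (z + t%:C * u) (g (z + t%:C * u))) ->
  (forall t, 0 <= t <= T -> is_rderive u g (z + t%:C * u) (k (z + t%:C * u))) ->
  (forall t, 0 <= t <= T -> p (k (z + t%:C * u)) <= M) ->
  p (f (z + T%:C * u) - f z - T%:C *: g z) <= M * T ^+ 2.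
Proof.
move=> T0 df dg Mk.
have M0 : 0 <= M by apply: le_trans (Mk 0 _); [exact: seminorm_ge0|rewrite lexx].
have line t h : z + t%:C * u + h%:C * u = z + (t + h)%:C * u.
  by rewrite rmorphD/= mulrDl addrA.
have gM t : 0 <= t <= T -> p (g (z + t%:C * u) - g z) <= M * T.
  move=> /andP[t0 tT].
  apply: (@le_trans _ _ (M * t)); last by rewrite ler_wpM2l.
  have := @seminorm_mvt (fun s => g (z + s%:C * u)) (fun s => k (z + s%:C * u)) t M t0.
  rewrite /= mul0r addr0; apply.
    move=> s /andP[s0 st]; have := dg s; rewrite s0 (le_trans st)// => /(_ isT).
    by rewrite /is_rderive /diff_quotient; under eq_fun do rewrite line.
  by move=> s /andP[s0 st]; apply: Mk; rewrite s0 (le_trans st).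
have := @seminorm_mvt (fun s => f (z + s%:C * u) - s%:C *: g z)
  (fun s => g (z + s%:C * u) - g z) T (M * T) T0.
rewrite /= mul0r addr0 scale0r subr0 expr2 mulrA [_ - _ - f z]addrAC; apply => // t tT.
have -> : (fun h : R => (h^-1)%:C *: (f (z + (t + h)%:C * u) - (t + h)%:C *: g z -
      (f (z + t%:C * u) - t%:C *: g z))) =
    (fun h => diff_quotient u f (z + t%:C * u) h + - ((h^-1 * h)%:C *: g z)).
  apply/funext => h; rewrite /diff_quotient line rmorphM/= -scalerA -scalerBr.
  congr (_ *: _); rewrite rmorphD/= scalerDl !opprD opprK !addrA.
  by rewrite addrAC [in RHS]addrAC -!addrA; congr (_ + _); rewrite addrC -!addrA; congr (_ + _); rewrite addrC addrNK.
apply: tvs_cvgD; first exact: df.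
apply: tvs_cvgN; apply: cvg_near_cst; near=> h.
by rewrite mulVf ?scale1r//; near: h; exact: nbhs_dnbhs_neq.
Unshelve. all: by end_near.
Qed.

End MeanValue.

(** * Multiples of absolutely convex sets *)

Section Scaled.
Variables (R : realType) (E : tvsType R[i]).
Implicit Types (B : set E) (s t : R) (x y : E).

Definition scaled t B : set E := [set t%:C *: y | y in B].

Lemma scaledD B s t x y : absolutely_convex B -> 0 <= s -> 0 <= t ->
  scaled s B x -> scaled t B y -> scaled (s + t) B (x + y).
Proof.
move=> cB s0 t0 [x' Bx <-] [y' By <-].
have [st0|st0] := eqVneq (s + t) 0.
  have : s = 0 /\ t = 0 by split; lra.
  move=> [-> ->]; rewrite addr0; exists x' => //.
  by rewrite !scale0r addr0.
have stp : 0 < s + t by rewrite lt_def st0 addr_ge0.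
exists ((s / (s + t))%:C *: x' + (t / (s + t))%:C *: y').
  apply: cB => //; rewrite !normc_real !ger0_norm ?divr_ge0 ?addr_ge0//.
  by rewrite -mulrDl divff.
by rewrite scalerDr !scalerA -!rmorphM/= ![(s + t) * _]mulrC !divfK.
Qed.

Lemma scaledZ B (c : R[i]) t t' y : absolutely_convex B ->
  0 <= t -> normc c * t <= t' -> scaled t B y -> scaled t' B (c *: y).
Proof.
move=> cB t0 ct [y' By <-].
have t'0 : 0 <= t' by apply: le_trans ct; rewrite mulr_ge0// normc_ge0.
have [tz|tn0] := eqVneq t' 0.
  have /eqP : normc c * t = 0 by apply/eqP; rewrite eq_le mulr_ge0 ?normc_ge0// andbT -tz.
  rewrite scalerA mulf_eq0 tz => /orP[/eqP/eq0_normc ->|/eqP ->].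
    by exists y' => //; rewrite mul0r.
  by exists y' => //; rewrite mulr0.
have t'p : 0 < t' by rewrite lt_def tn0.
exists ((c * t%:C / t'%:C) *: y' + 0 *: y').
  apply: cB => //; rewrite normc0 addr0 !normcM normcV !normc_real.
  by rewrite (ger0_norm t0) (ger0_norm t'0) ler_pdivrMr// mul1r.
rewrite scale0r addr0 !scalerA mulrC divfK//.
by rewrite (fmorph_eq0 (real_complex R)).
Qed.

Lemma scaled_le B s t y : absolutely_convex B -> 0 <= s -> s <= t ->
  scaled s B y -> scaled t B y.
Proof.
move=> cB s0 st By; rewrite -[y]scale1r.
by apply: (@scaledZ B 1 s) => //; rewrite normc1 mul1r.
Qed.

Lemma scaled_sum B n (t : R) (f : 'I_n -> E) : absolutely_convex B -> B !=set0 ->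
  0 <= t -> (forall i, scaled t B (f i)) -> scaled (n%:R * t) B (\sum_i f i).
Proof.
move=> cB [b Bb] t0; elim: n f => [|n IH] f fB.
  by rewrite big_ord0 mul0r; exists b => //; rewrite scale0r.
rewrite big_ord_recr/= -natr1 mulrDl mul1r; apply: scaledD => //.
  by rewrite mulr_ge0.
exact: IH.
Qed.

End Scaled.

(** * Derivatives along a direction *)

Section RealDerivatives.
Variable R : realType.
Implicit Types (n : nat) (s t : R).

Lemma expR_ge_Xn n t : 0 <= t -> t ^+ n <= n`!%:R * expR t.
Proof.
move=> t0; case: n => [|n].
  by rewrite expr0 fact0 mul1r -expR0 ler_expR.
rewrite -ler_pdivrMl ?ltr0n ?fact_gt0// mulrC.
by apply: le_trans (expR_ge1Dxn n t0); rewrite lerDr.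
Qed.

(* The index makes the family stable under differentiation. *)
Definition flat n t : R := if 0 < t then t^-1 ^+ n * expR (- t^-1) else 0.

Lemma flat_ge0 n t : 0 <= flat n t.
Proof.
rewrite /flat; case: ifP => // t0.
by rewrite mulr_ge0 ?expR_ge0// exprn_ge0// invr_ge0 ltW.
Qed.

Lemma flat_le n t : flat n t <= n`!%:R.
Proof.
rewrite /flat; case: ifP => // t0.
by rewrite expRN ler_pdivrMr ?expR_gt0// expR_ge_Xn// invr_ge0 ltW.
Qed.

Lemma flat_eq0 n t : t <= 0 -> flat n t = 0.
Proof. by rewrite /flat ltNge => ->. Qed.

Lemma flat_shift n t : 0 < t -> flat n t = t * flat n.+1 t.
Proof.
by move=> t0; rewrite /flat t0 exprS mulrA mulrA divff ?mul1r// gt_eqF.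
Qed.

(** The delicate point is 0: for r > 0, [flat n r] is r^2 times [flat n.+2 r], and the latter is at
    most (n+2)!, so the difference quotient is O(r). *)
Lemma is_derive_flat n t :
  is_derive t 1 (flat n) (- n%:R * flat n.+1 t + flat n.+2 t).
Proof.
have [t0|t0|->] := ltgtP t 0.
- rewrite !flat_eq0 ?(ltW t0)// mulr0 addr0.
  apply: near_eq_is_derive (is_derive_cst (0 : R) t (1 : R)).
  near=> s; rewrite flat_eq0// ltW//; near: s; exact: lt_nbhsl.
- have tn0 : t != 0 by rewrite gt_eqF.
  apply: (@near_eq_is_derive _ _ _ ((fun s => s ^+ n * expR (- s)) \o GRing.inv)).
    by near=> s; rewrite /flat /= ifT//; near: s; exact: lt_nbhsr.
  pose f := fun s : R => s ^+ n * expR (- s).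
  have df s : is_derive s 1 f (n%:R * s ^+ n.-1 * expR (- s) - s ^+ n * expR (- s)).
    have de : is_derive s 1 (fun s => expR (- s)) (- expR (- s)).
      have := is_derive1_comp (is_derive_expR (- s)) (is_deriveNid s 1).
      by rewrite mulrN1.
    have -> : f = (id : R -> R) ^+ n * (fun s => expR (- s)).
      by apply/funext => x; rewrite mulrfctE exprfctE.
    apply: (is_derive_eq (is_deriveM (is_deriveX n (is_derive_id s (1 : R))) de)).
    by rewrite exprfctE /GRing.scale /=; ring.
  have di : is_derive t 1 (GRing.inv : R -> R) (- (t^-1) ^+ 2).
    apply: (is_derive_eq (@is_deriveV _ id t 1 1 tn0 (is_derive_id t (1 : R)))).
    by rewrite /GRing.scale /= mulr1 exprVn.
  apply: (is_derive_eq (is_derive1_comp (df _) di)).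
  rewrite /flat t0 !exprS; case: n {f df} => [|n] /=; first by ring.
  by rewrite !exprS; ring.
- rewrite !flat_eq0// mulr0 addr0.
  have H : h^-1 *: ((flat n \o shift 0) (h *: 1) - flat n 0) @[h --> 0^'] --> (0 : R).
    apply: (@cvg_to_0_linear _ _ (n.+2)`!%:R 1) => // r _.
    have -> : (flat n \o shift 0) (r *: 1) = flat n r.
      by rewrite /= addr0 /GRing.scale /= mulr1.
    rewrite (@flat_eq0 _ 0)// subr0 /GRing.scale /=.
    have [r0|r0] := leP r 0; first by rewrite flat_eq0// mulr0 normr0 mulr_ge0.
    rewrite flat_shift// (flat_shift n.+1)// mulKf ?gt_eqF// normrM mulrC.
    by rewrite ler_wpM2r// ger0_norm ?flat_ge0 ?flat_le.
  by constructor; [apply: cvgP H|apply: cvg_lim H].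
Unshelve. all: by end_near.
Qed.

Lemma is_derive_cvg (f : R -> R) t d : is_derive t 1 f d ->
  h^-1 * (f (t + h) - f t) @[h --> 0^'] --> d.
Proof.
case=> df <-; have := df; rewrite /derivable /derive => /cvg_ex[l fl].
rewrite (cvg_lim _ fl)//.
have -> : (fun h : R => h^-1 * (f (t + h) - f t)) =
    (fun h => h^-1 *: ((f \o shift t) (h *: 1) - f t)).
  apply/funext => h /=; have -> : h%:A = h :> R by rewrite /GRing.scale /= mulr1.
  by rewrite [t + h]addrC.
exact: fl.
Qed.

Lemma is_derive_cont (f : R -> R) t d : is_derive t 1 f d -> {for t, continuous f}.
Proof.
by move=> df; apply: differentiable_continuous; apply/derivable1_diffP; case: df.
Qed.

End RealDerivatives.

Section Rderive.
Variables (R : realType) (E : tvsType R[i]).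
Implicit Types (f g : Cplane R -> E) (a b : Cplane R -> Cplane R) (z v w : Cplane R).

Lemma cvg_line z v : z + h%:C * v @[h --> (0 : R)] --> z.
Proof.
rewrite -[X in _ --> X]addr0; apply: tvs_cvgD; first exact: cvg_cst.
rewrite -[X in _ --> X](scale0r v).
have := @tvs_cvgZ R (Cplane R) R (nbhs (0 : R)) _ (fun h => h%:C) (fun=> v) 0 v.
apply; last exact: cvg_cst.
exact: (@real_complex_continuous R 0).
Qed.

Lemma is_rderive_near f g v z l : (\forall w \near z, f w = g w) ->
  is_rderive v f z l -> is_rderive v g z l.
Proof.
move=> fg; rewrite /is_rderive; apply: cvg_trans; apply: near_eq_cvg.
apply: cvg_within; apply: (@filterS _ (nbhs (0 : R)) _
  (fun h => f (z + h%:C * v) = g (z + h%:C * v))) => [h fgh|].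
  by rewrite /diff_quotient fgh (nbhs_singleton fg).
exact: (@cvg_line z v _ fg).
Qed.

Lemma is_rderive_cst v (c : E) z : is_rderive v (fun=> c) z 0.
Proof.
rewrite /is_rderive /diff_quotient.
by under eq_fun do rewrite subrr scaler0; exact: cvg_cst.
Qed.

Lemma is_rderiveD v f g z l m : is_rderive v f z l -> is_rderive v g z m ->
  is_rderive v (fun w => f w + g w) z (l + m).
Proof.
move=> fl gm; rewrite /is_rderive.
have -> : diff_quotient v (fun w => f w + g w) z =
    (fun h => diff_quotient v f z h + diff_quotient v g z h).
  by apply/funext => h; rewrite /diff_quotient -scalerDr opprD addrACA.
exact: tvs_cvgD.
Qed.

(** The increment of [f] is paired with the moved value of [a], so continuity along the line is
    needed for [a] alone, and it follows from the existence of its derivative. *)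
Lemma is_rderiveM v a f z l m : is_rderive v a z l -> is_rderive v f z m ->
  is_rderive v (fun w => (a w : R[i]) *: f w) z ((l : R[i]) *: f z + (a z : R[i]) *: m).
Proof.
move=> al fm; rewrite /is_rderive.
have az : a (z + h%:C * v) @[h --> 0^'] --> a z.
  have c0 : (fun h : R => h%:C : Cplane R) @ 0^' --> ((0 : R)%:C : Cplane R).
    by apply: cvg_trans (@real_complex_continuous R 0); apply: cvg_app; exact: cvg_within.
  have ca : (fun _ : R => a z) @ 0^' --> a z by exact: cvg_cst.
  have FF : Filter (0 : R)^' by exact: dnbhs_filter.
  have := tvs_cvgD ca (tvs_cvgZ c0 al) => /(_ FF FF) H.
  rewrite rmorph0 scale0r addr0 in H; apply: cvg_trans H; apply: near_eq_cvg.
  near=> h; rewrite /diff_quotient scalerA -rmorphM/= divff ?scale1r.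
    by rewrite addrC subrK.
  near: h; exact: nbhs_dnbhs_neq.
have -> : diff_quotient v (fun w => (a w : R[i]) *: f w) z =
    (fun h => (diff_quotient v a z h : R[i]) *: f z +
              (a (z + h%:C * v) : R[i]) *: diff_quotient v f z h).
  apply/funext => h; rewrite /diff_quotient.
  have -> (c x : R[i]) (y : E) : ((c *: (x : R[i]^o)) : R[i]) *: y = c *: (x *: y).
    by rewrite scalerA.
  rewrite [X in _ = _ + X]scalerA [a _ * _]mulrC -scalerA -scalerDr.
  by congr (_ *: _); rewrite scalerBl scalerBr [in RHS]addrC addrA addrNK.
have cf : (fun _ : R => f z) @ 0^' --> f z by exact: cvg_cst.
exact: tvs_cvgD (tvs_cvgZ al cf) (tvs_cvgZ az fm).
Unshelve. all: by end_near.
Qed.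

Hypothesis hE : hausdorff_space E.

Lemma is_rderive_unique v f z l m :
  is_rderive v f z l -> is_rderive v f z m -> l = m.
Proof. by apply: (cvg_unique hE). Qed.

Lemma rderiveE v f z l : is_rderive v f z l -> rderive v f z = l.
Proof.
move=> fl; apply: (@is_rderive_unique v f z) => //.
by apply: (@xgetPex _ 0 [set m | is_rderive v f z m]); exists l.
Qed.

Lemma rderivableP v f z : rderivable v f z -> is_rderive v f z (rderive v f z).
Proof. by case=> l fl; rewrite (rderiveE fl). Qed.

End Rderive.

Section ScalarDerivatives.
Variable R : realType.
Implicit Types (a : Cplane R -> Cplane R) (z v w : Cplane R).

Lemma plane_hausdorff : hausdorff_space (Cplane R).
Proof. exact: norm_hausdorff. Qed.

Lemma is_rderive_ReIm v a z (x y : R -> R) (x' y' : R) :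
  (forall t, a (z + t%:C * v) = x t +i* y t) ->
  is_derive (0 : R) 1 x x' -> is_derive (0 : R) 1 y y' -> is_rderive v a z (x' +i* y').
Proof.
move=> axy /is_derive_cvg dx /is_derive_cvg dy; rewrite /is_rderive.
have Ec (s t : R) : s +i* t = s%:C + 'i%C * t%:C :> Cplane R by simpc.
have -> : diff_quotient v a z = (fun h =>
   (h^-1 * (x (0 + h) - x 0))%:C + 'i%C *: (h^-1 * (y (0 + h) - y 0))%:C).
  apply/funext => h; rewrite /diff_quotient axy -[z]addr0 -(mul0r v).
  rewrite -[X in X * v](rmorph0 (real_complex R)) axy !add0r.
  apply/eqP; rewrite eq_complex /=; apply/andP; split; apply/eqP; ring.
rewrite Ec; apply: tvs_cvgD.
  by apply: cvg_comp dx _; exact: real_complex_continuous.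
apply: tvs_cvgZ; first exact: cvg_cst.
by apply: cvg_comp dy _; exact: real_complex_continuous.
Qed.

Lemma is_rderive_real v (u : R -> R) (u' al be c : R) z :
  is_derive (al * complex.Re z + be * complex.Im z + c) 1 u u' ->
  is_rderive v (fun w => (u (al * complex.Re w + be * complex.Im w + c))%:C : Cplane R) z
   ((al * complex.Re v + be * complex.Im v) * u')%:C.
Proof.
case: z v => z1 z2 [v1 v2] /=.
set s := al * _ + _ + c; set k := al * _ + _ => du.
apply: (@is_rderive_ReIm _ _ _ (fun t => u (s + t * k)) (fun=> 0)).
  by move=> t; congr ((u _) +i* _); rewrite /s /k /=; ring.
have ds : is_derive (0 : R) 1 (fun t => s + t * k) k.
  by apply: is_derive_eq; rewrite /GRing.scale /=; ring.
rewrite mulrC; have := @is_derive1_comp R u (fun t => s + t * k) 0 u' k.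
by apply => //; rewrite mul0r addr0.
Qed.

Definition cexp (w : Cplane R) : Cplane R :=
  (expR (complex.Re w) * cos (complex.Im w)) +i*
  (expR (complex.Re w) * sin (complex.Im w)).

Lemma normc_cexp w : normc (cexp w : R[i]) = expR (complex.Re w).
Proof.
rewrite /normc /cexp !exprMn -mulrDr cos2Dsin2 mulr1 sqrtr_sqr.
by rewrite ger0_norm ?expR_ge0.
Qed.

Lemma cexpN w : cexp w * cexp (- w) = 1.
Proof.
case: w => x y; apply/eqP; rewrite eq_complex /cexp /= cosN sinN expRN.
have e0 : expR x != 0 by rewrite gt_eqF// expR_gt0.
apply/andP; split; apply/eqP; last by ring.
by rewrite mulrN mulrN opprK mulrACA divff// mul1r mulrACA divff// mul1r -!expr2 cos2Dsin2.
Qed.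

(** The exponents in use are quadratic polynomials, so along any line they are quadratic in the real
    parameter; the chain rule is then only required for real functions, in the two components. *)
Lemma is_rderive_cexp v a z (w1 w2 : Cplane R) :
  (forall t, a (z + t%:C * v) = a z + t%:C * w1 + (t ^+ 2)%:C * w2) ->
  is_rderive v (cexp \o a) z (w1 * cexp (a z)).
Proof.
move=> aE; case E0 : (a z) => [p q]; case: w1 aE => w11 w12; case: w2 => w21 w22 aE.
have -> : (w11 +i* w12 : Cplane R) * cexp (p +i* q) =
   (expR p * cos q * w11 - expR p * sin q * w12) +i*
   (expR p * cos q * w12 + expR p * sin q * w11) :> Cplane R.
  by apply/eqP; rewrite eq_complex /=; apply/andP; split; apply/eqP; ring.
pose A t := p + t * w11 + t ^+ 2 * w21; pose B t := q + t * w12 + t ^+ 2 * w22.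
have dA : is_derive (0 : R) 1 A w11.
  by apply: is_derive_eq; rewrite /GRing.scale /=; ring.
have dB : is_derive (0 : R) 1 B w12.
  by apply: is_derive_eq; rewrite /GRing.scale /=; ring.
have A0 : A 0 = p by rewrite /A; ring.
have B0 : B 0 = q by rewrite /B; ring.
have dexp : is_derive (0 : R) 1 (expR \o A) (expR p * w11).
  by rewrite -A0; apply: is_derive1_comp.
have dcos : is_derive (0 : R) 1 (cos \o B) (- sin q * w12).
  by rewrite -B0; apply: is_derive1_comp.
have dsin : is_derive (0 : R) 1 (sin \o B) (cos q * w12).
  by rewrite -B0; apply: is_derive1_comp.
apply: (@is_rderive_ReIm _ _ _ ((expR \o A) * (cos \o B)) ((expR \o A) * (sin \o B))).
- move=> t; rewrite /= aE E0 /cexp; set W := (X in expR (complex.Re X)).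
  have -> : complex.Re W = A t by rewrite /W /A /=; ring.
  by have -> : complex.Im W = B t by rewrite /W /B /=; ring.
- apply: is_derive_eq; rewrite /GRing.scale /= A0 B0; ring.
- apply: is_derive_eq; rewrite /GRing.scale /= A0 B0; ring.
Qed.

End ScalarDerivatives.

Section PlaneContinuity.
Variable R : realType.
Implicit Types (a b : Cplane R -> Cplane R) (x y : Cplane R -> R) (z : Cplane R).

Lemma plane_cont_cst (c : Cplane R) z : {for z, continuous (fun _ : Cplane R => c)}.
Proof. exact: cst_continuous. Qed.

Lemma plane_contD a b z : {for z, continuous a} -> {for z, continuous b} ->
  {for z, continuous (fun w => a w + b w)}.
Proof.
move=> ca cb; have FF : Filter (nbhs z) by exact: nbhs_filter.
have H := @tvs_cvgD R (Cplane R) (Cplane R) (nbhs z) FF a b (a z) (b z) ca cb.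
exact: H.
Qed.

Lemma plane_contM a b z : {for z, continuous a} -> {for z, continuous b} ->
  {for z, continuous (fun w => a w * b w)}.
Proof.
move=> ca cb; have FF : Filter (nbhs z) by exact: nbhs_filter.
have H := @tvs_cvgZ R (Cplane R) (Cplane R) (nbhs z) FF a b (a z) (b z) ca cb.
exact: H.
Qed.

Lemma plane_cont_affine (c : Cplane R) z : {for z, continuous (fun w : Cplane R => w - c)}.
Proof. by apply: (@plane_contD id); [exact: cvg_id|exact: plane_cont_cst]. Qed.

Lemma plane_cont_real x z : {for z, continuous x} ->
  {for z, continuous (fun w => (x w)%:C : Cplane R)}.
Proof.
move=> cx; apply: (@continuous_comp _ _ _ x (fun t : R => t%:C : Cplane R)) => //.
exact: real_complex_continuous.
Qed.

Lemma plane_cont_comp (f : R -> R) x z : {for z, continuous x} ->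
  {for x z, continuous f} -> {for z, continuous (f \o x)}.
Proof. exact: continuous_comp. Qed.

Lemma plane_cont_cexp a z : {for z, continuous a} ->
  {for z, continuous (fun w => cexp (a w))}.
Proof.
move=> ca.
have cre : {for z, continuous (fun w => complex.Re (a w))}.
  by apply: continuous_comp => //; exact: Re_continuous.
have cim : {for z, continuous (fun w => complex.Im (a w))}.
  by apply: continuous_comp => //; exact: Im_continuous.
have -> : (fun w => cexp (a w)) = (fun w =>
   (expR (complex.Re (a w)))%:C * ((cos (complex.Im (a w)))%:C +
     'i%C * (sin (complex.Im (a w)))%:C)).
  by apply/funext => w; rewrite /cexp; simpc.
apply: plane_contM.
  apply: plane_cont_real; apply: (plane_cont_comp cre); exact: continuous_expR.
apply: plane_contD.
  apply: plane_cont_real; apply: (plane_cont_comp cim); exact: continuous_cos.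
apply: plane_contM; first exact: plane_cont_cst.
apply: plane_cont_real; apply: (plane_cont_comp cim); exact: continuous_sin.
Qed.

Lemma plane_cont_ReIm (al be c : R) z :
  {for z, continuous (fun w : Cplane R => al * complex.Re w + be * complex.Im w + c)}.
Proof.
have cst (t : R) : (fun _ : Cplane R => t) @ nbhs z --> t.
  exact: cst_continuous.
have cr : (fun w => al * complex.Re w) @ nbhs z --> al * complex.Re z.
  by apply: cvgM; [exact: cst|exact: Re_continuous].
have ci : (fun w => be * complex.Im w) @ nbhs z --> be * complex.Im z.
  by apply: cvgM; [exact: cst|exact: Im_continuous].
have cri : (fun w => al * complex.Re w + be * complex.Im w) @ nbhs z -->
    al * complex.Re z + be * complex.Im z by exact: cvgD.
have H : (fun w => al * complex.Re w + be * complex.Im w + c) @ nbhs z -->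
    al * complex.Re z + be * complex.Im z + c by exact: cvgD.
exact: H.
Qed.

End PlaneContinuity.

(** * Families with polynomially bounded derivatives *)

Section Families.
Variables (R : realType) (D : nat -> set (Cplane R)) (lam : nat -> R).
Hypothesis lam1 : forall i, 1 <= lam i.
Implicit Types (u v : nat -> Cplane R -> Cplane R) (k : nat).

(* Powers of [lam] are harmless: [damping] below decays faster than all of them. *)
Definition poly_bounded u := exists (C : R) (p : nat), 0 <= C /\
  forall i z, D i z -> normc (u i z : R[i]) <= C * lam i ^+ p.

(** Derivatives exist on the whole plane, but bounds are imposed on [D i] only: the exponential
    factor is entire and becomes huge away from its box. *)
Fixpoint smooth_family k u : Prop :=
  [/\ poly_bounded u, (forall i z, {for z, continuous (u i)}) &
    if k is k'.+1 then exists ux uy,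
      [/\ (forall i z, is_rderive 1 (u i) z (ux i z)),
          (forall i z, is_rderive 'i%C (u i) z (uy i z)),
          smooth_family k' ux & smooth_family k' uy]
    else True].

Lemma poly_boundedD u v : poly_bounded u -> poly_bounded v ->
  poly_bounded (fun i z => u i z + v i z).
Proof.
move=> [C [p [C0 Cu]]] [C' [p' [C'0 Cv]]]; exists (C + C'), (maxn p p').
split=> [|i z Dz]; first by rewrite addr_ge0.
apply: le_trans (ler_normcD _ _) _; rewrite mulrDl; apply: lerD.
  by apply: le_trans (Cu i z Dz) _; rewrite ler_wpM2l// ler_weXn2l// leq_maxl.
by apply: le_trans (Cv i z Dz) _; rewrite ler_wpM2l// ler_weXn2l// leq_maxr.
Qed.

Lemma poly_boundedM u v : poly_bounded u -> poly_bounded v ->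
  poly_bounded (fun i z => u i z * v i z).
Proof.
move=> [C [p [C0 Cu]]] [C' [p' [C'0 Cv]]]; exists (C * C'), (p + p')%N.
split=> [|i z Dz]; first by rewrite mulr_ge0.
rewrite normcM exprD mulrACA; apply: ler_pM; rewrite ?normc_ge0//.
  exact: Cu.
exact: Cv.
Qed.

Lemma smooth_familyW k u : smooth_family k.+1 u -> smooth_family k u.
Proof.
elim: k u => [|k IH] u [bu cu [ux [uy [dx dy sx sy]]]]; split=> //.
by exists ux, uy; split=> //; exact: IH.
Qed.

Lemma smooth_familyD k u v : smooth_family k u -> smooth_family k v ->
  smooth_family k (fun i z => u i z + v i z).
Proof.
elim: k u v => [|k IH] u v [bu cu du] [bv cv dv].
  split; [exact: poly_boundedD| |exact: I].
  by move=> i z; exact: plane_contD (cu i z) (cv i z).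
split; first exact: poly_boundedD.
  by move=> i z; exact: plane_contD (cu i z) (cv i z).
case: du => ux [uy [ux1 uyi sux suy]]; case: dv => vx [vy [vx1 vyi svx svy]].
exists (fun i z => ux i z + vx i z), (fun i z => uy i z + vy i z).
by split; [move=> i z; exact: is_rderiveD|move=> i z; exact: is_rderiveD| exact: IH|exact: IH].
Qed.

Lemma is_rderive_mul (a b : Cplane R -> Cplane R) (d z l m : Cplane R) :
  is_rderive d a z l -> is_rderive d b z m ->
  is_rderive d (fun w => a w * b w) z (l * b z + a z * m).
Proof. exact: is_rderiveM. Qed.

Lemma smooth_familyM k u v : smooth_family k u -> smooth_family k v ->
  smooth_family k (fun i z => u i z * v i z).
Proof.
elim: k u v => [|k IH] u v su sv; move: (su) (sv) => [bu cu du] [bv cv dv].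
  split; [exact: poly_boundedM| |exact: I].
  by move=> i z; exact: plane_contM (cu i z) (cv i z).
split; first exact: poly_boundedM.
  by move=> i z; exact: plane_contM (cu i z) (cv i z).
case: du => ux [uy [ux1 uyi sux suy]]; case: dv => vx [vy [vx1 vyi svx svy]].
exists (fun i z => ux i z * v i z + u i z * vx i z).
exists (fun i z => uy i z * v i z + u i z * vy i z).
have su' := smooth_familyW su; have sv' := smooth_familyW sv.
split; [by move=> i z; exact: is_rderive_mul|by move=> i z; exact: is_rderive_mul| |].
  by apply: smooth_familyD; exact: IH.
by apply: smooth_familyD; exact: IH.
Qed.

Lemma smooth_family_cst k (c : nat -> Cplane R) :
  (exists (C : R) (p : nat), 0 <= C /\ forall i, normc (c i : R[i]) <= C * lam i ^+ p) ->
  smooth_family k (fun i _ => c i).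
Proof.
elim: k c => [|k IH] c [C [p [C0 cC]]].
  by split; [exists C, p|move=> i z; exact: plane_cont_cst|].
split; first by exists C, p.
  by move=> i z; exact: plane_cont_cst.
exists (fun _ _ => 0), (fun _ _ => 0); split.
- by move=> i z; exact: is_rderive_cst.
- by move=> i z; exact: is_rderive_cst.
- by apply: (IH (fun=> 0)); exists 0, 0%N; split=> // i; rewrite normc0 mul0r.
- by apply: (IH (fun=> 0)); exists 0, 0%N; split=> // i; rewrite normc0 mul0r.
Qed.

Lemma smooth_family_fixed k (c : Cplane R) : smooth_family k (fun _ _ => c).
Proof.
apply: smooth_family_cst; exists (normc (c : R[i])), 0%N.
by split=> [|i]; rewrite ?normc_ge0// expr0 mulr1.
Qed.

Lemma is_rderive_affine (c d z : Cplane R) : is_rderive d (fun w => w - c) z d.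
Proof.
rewrite /is_rderive; apply: cvg_near_cst; near=> h.
have -> : diff_quotient d (fun w => w - c) z h = (h^-1)%:C * (h%:C * d).
  by rewrite /diff_quotient /GRing.scale /=; congr (_ * _); ring.
rewrite mulrA -rmorphM/= mulVf ?mul1r//.
by near: h; exact: nbhs_dnbhs_neq.
Unshelve. all: by end_near.
Qed.

Lemma smooth_family_affine k (X : nat -> Cplane R) :
  (exists2 C : R, 0 <= C & forall i z, D i z -> normc (z - X i : R[i]) <= C) ->
  smooth_family k (fun i z => z - X i).
Proof.
move=> [C C0 DC].
have b : poly_bounded (fun i z => z - X i).
  by exists C, 0%N; split=> // i z /DC; rewrite expr0 mulr1.
have c i (z : Cplane R) : {for z, continuous (fun z : Cplane R => z - X i)}.
  exact: plane_cont_affine.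
case: k => [|k]; (split; [exact: b|by move=> i z; exact: c|]); first by [].
exists (fun _ _ => 1), (fun _ _ => 'i%C).
by split; [move=> i z; exact: is_rderive_affine|move=> i z; exact: is_rderive_affine| exact: smooth_family_fixed|exact: smooth_family_fixed].
Qed.

(** The induction on [k] is over all [n], since differentiation turns [flat n] into a combination of
    [flat n.+1] and [flat n.+2], at the price of one factor [lam i]. *)
Lemma smooth_family_flat k n (al be c : nat -> R) :
  (forall i, `|al i| <= lam i) -> (forall i, `|be i| <= lam i) ->
  smooth_family k (fun i z =>
    (flat n (al i * complex.Re z + be i * complex.Im z + c i))%:C).
Proof.
pose u m i (z : Cplane R) : Cplane R :=
  (flat m (al i * complex.Re z + be i * complex.Im z + c i))%:C.
move=> all bel; rewrite -/(u n); elim: k n => [|k IH] n.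
all: have b : poly_bounded (u n).
1,3: exists n`!%:R, 0%N; split=> [|i z _]; first exact: ler0n.
1,2: by rewrite normc_real ger0_norm ?flat_ge0// expr0 mulr1 flat_le.
all: have cn i z : {for z, continuous (u n i)}.
1,3: apply: plane_cont_real; apply: plane_cont_comp; first exact: plane_cont_ReIm.
1,2: exact: is_derive_cont (is_derive_flat _ _).
  by split; [exact: b|exact: cn|].
split; [exact: b|exact: cn|].
have d (v : Cplane R) i z : is_rderive v (u n i) z
    ((al i * complex.Re v + be i * complex.Im v)%:C *
     ((- n%:R)%:C * u n.+1 i z + u n.+2 i z)).
  have := @is_rderive_real R v (flat n) _ (al i) (be i) (c i) z (is_derive_flat _ _).
  set s := _ + c i.
  have -> : (- n%:R)%:C * u n.+1 i z + u n.+2 i z =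
      ((- n%:R) * flat n.+1 s + flat n.+2 s)%:C.
    by rewrite [RHS]rmorphD [in RHS]rmorphM.
  by rewrite -rmorphM.
have s (v : Cplane R) : smooth_family k (fun i z =>
    ((al i * complex.Re v + be i * complex.Im v)%:C *
     ((- n%:R)%:C * u n.+1 i z + u n.+2 i z))).
  apply: smooth_familyM.
    apply: smooth_family_cst; exists (`|complex.Re v| + `|complex.Im v|), 1%N.
    split=> [|i]; first by rewrite addr_ge0.
    rewrite normc_real expr1 mulrDl; apply: le_trans (ler_normD _ _) _.
    by rewrite !normrM ![_ * lam i]mulrC lerD// ler_wpM2r.
  by apply: smooth_familyD => //; apply: smooth_familyM => //; exact: smooth_family_fixed.
exists (fun i z => ((al i * complex.Re (1 : R[i]) + be i * complex.Im (1 : R[i]))%:C *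
     ((- n%:R)%:C * u n.+1 i z + u n.+2 i z))).
exists (fun i z => ((al i * complex.Re ('i%C : R[i]) + be i * complex.Im ('i%C : R[i]))%:C *
     ((- n%:R)%:C * u n.+1 i z + u n.+2 i z))).
by split; [exact: d|exact: d|exact: s|exact: s].
Qed.

(* The linear part makes [exp phase] decay in the imaginary direction, the
   quadratic part in the real direction. *)
Definition phase (mu c : R) (X z : Cplane R) : Cplane R :=
  mu%:C * ('i%C * (z - X) - c%:C * (z - X) ^+ 2).

(** A derivative is the function itself times an affine factor of size O([lam i]) on [D i], so a
    bound on the undifferentiated function is all that has to be supplied. *)
Lemma smooth_family_cexp k (mu amp : nat -> R) (c C : R) (X : nat -> Cplane R) :
  0 <= C -> (forall i, `|mu i| <= C * lam i) ->
  (forall i z, D i z -> normc (z - X i : R[i]) <= C) ->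
  poly_bounded (fun i z => (amp i)%:C * cexp (phase (mu i) c (X i) z)) ->
  smooth_family k (fun i z => (amp i)%:C * cexp (phase (mu i) c (X i) z)).
Proof.
move=> C0 muC DC b.
have d (v : Cplane R) i z : is_rderive v (fun z => (amp i)%:C * cexp (phase (mu i) c (X i) z) : Cplane R) z
    ((mu i)%:C * ('i%C * v - (2 * c)%:C * v * (z - X i)) *
      ((amp i)%:C * cexp (phase (mu i) c (X i) z))).
  set w1 := (mu i)%:C * _.
  have quad t : phase (mu i) c (X i) (z + t%:C * v) =
      phase (mu i) c (X i) z + t%:C * w1 + (t ^+ 2)%:C * (- (mu i)%:C * c%:C * v ^+ 2).
    rewrite /w1 /phase [(2 * c)%:C]rmorphM [(t ^+ 2)%:C]rmorphXn /=.
    by rewrite (rmorph_nat (real_complex R) 2); ring.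
  have H := @is_rderive_mul (fun=> (amp i)%:C) _ v z 0 _ (is_rderive_cst _ _ _)
    (is_rderive_cexp quad).
  rewrite [X in is_rderive _ _ _ X](_ : _ = 0 * (@cexp R \o phase (mu i) c (X i)) z +
      (amp i)%:C * (w1 * cexp (phase (mu i) c (X i) z))); first exact: H.
  by rewrite mul0r add0r mulrCA.
have cont i z : {for z, continuous (fun z => (amp i)%:C * cexp (phase (mu i) c (X i) z) : Cplane R)}.
  apply: plane_contM; first exact: plane_cont_cst.
  apply: plane_cont_cexp; apply: plane_contM; first exact: plane_cont_cst.
  apply: plane_contD.
    by apply: plane_contM; [exact: plane_cont_cst|exact: plane_cont_affine].
  have -> : (fun w : Cplane R => - (c%:C * (w - X i) ^+ 2)) =
      (fun w => (- c%:C) * ((w - X i) * (w - X i))).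
    by apply/funext => w; rewrite mulNr expr2.
  apply: plane_contM; first exact: plane_cont_cst.
  by apply: plane_contM; exact: plane_cont_affine.
elim: k => [|k IH]; first by split; [exact: b|exact: cont|].
split; [exact: b|exact: cont|].
exists (fun i z => (mu i)%:C * ('i%C * 1 - (2 * c)%:C * 1 * (z - X i)) *
      ((amp i)%:C * cexp (phase (mu i) c (X i) z))).
exists (fun i z => (mu i)%:C * ('i%C * 'i%C - (2 * c)%:C * 'i%C * (z - X i)) *
      ((amp i)%:C * cexp (phase (mu i) c (X i) z))).
have s (v : Cplane R) : smooth_family k (fun i z => (mu i)%:C * ('i%C * v - (2 * c)%:C * v * (z - X i)) *
      ((amp i)%:C * cexp (phase (mu i) c (X i) z))).
  apply: smooth_familyM => //; apply: smooth_familyM.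
    apply: smooth_family_cst; exists C, 1%N; split=> // i.
    by rewrite normc_real expr1.
  apply: (@smooth_familyD k (fun _ _ => _)); first exact: smooth_family_fixed.
  have -> : (fun (i : nat) (z : Cplane R) => - ((2 * c)%:C * v * (z - X i))) =
      (fun i z => (- ((2 * c)%:C * v)) * (z - X i)).
    by apply/funext => i; apply/funext => z; rewrite mulNr.
  apply: smooth_familyM; first exact: smooth_family_fixed.
  by apply: smooth_family_affine; exists C.
by split; [exact: d|exact: d|exact: s|exact: s].
Qed.

End Families.

(** * Superpositions of separated pieces *)

Section Glue.
Variables (R : realType) (E : tvsType R[i]).
Hypothesis hE : hausdorff_space E.
Variables (X : nat -> R) (S : nat -> set (Cplane R)) (x : nat -> E) (lam : nat -> R).
Hypothesis lam1 : forall i, 1 <= lam i.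
Hypothesis Xsep : forall i j, i != j -> 2 <= `|X i - X j|.
Hypothesis SX : forall i z, S i z -> `|complex.Re z - X i| <= 4^-1.
Hypothesis Sclosed : forall i, closed (S i).
Implicit Types (u : nat -> Cplane R -> Cplane R) (z w : Cplane R).

Definition supported u := forall i z, ~ S i z -> u i z = 0.

(* At most one centre is at distance less than 1. If there is none, [xget]
   returns the junk index 0, and [u 0 z] vanishes for a [supported] family. *)
Definition gluing u z : E :=
  let i := xget 0%N [set i | `|complex.Re z - X i| < 1] in (u i z : R[i]) *: x i.

Lemma gluingE u z i : `|complex.Re z - X i| < 1 -> gluing u z = (u i z : R[i]) *: x i.
Proof.
move=> zi; rewrite /gluing; have : `|complex.Re z - X (xget 0%N [set i | `|complex.Re z - X i| < 1])| < 1.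
  by apply: (@xgetPex _ 0%N [set i | `|complex.Re z - X i| < 1]); exists i.
set j := xget _ _ => zj; have [->//|ij] := eqVneq j i.
exfalso; have := Xsep ij; apply/negP; rewrite -ltNge.
have -> : X j - X i = (complex.Re z - X i) - (complex.Re z - X j) by lra.
by apply: le_lt_trans (ler_normB _ _) _; lra.
Qed.

Lemma gluing_cases u z : supported u ->
  gluing u z = 0 \/ exists i, S i z /\ gluing u z = (u i z : R[i]) *: x i.
Proof.
move=> su; set i := xget 0%N [set i | `|complex.Re z - X i| < 1].
have [Sz|nSz] := pselect (S i z); first by right; exists i.
by left; rewrite /gluing su// scale0r.
Qed.

(** The index is chosen before the family [u], so that a family and the family of its derivatives
    are described by the same index near [z]. *)
Lemma gluing_local z : exists i, forall w, `|complex.Re w - complex.Re z| < 4^-1 ->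
  forall u, supported u -> gluing u w = (u i w : R[i]) *: x i.
Proof.
have tri i w : `|complex.Re w - X i| <= `|complex.Re w - complex.Re z| + `|complex.Re z - X i|.
  by apply: le_trans (ler_normD _ _); rewrite addrA subrK.
(* A centre within 3/4 of [z] stays within 1 of every [w]. If there is none, no support, being
   within 1/4 of its centre, contains such a [w], and any index will do. *)
have [[i zi]|no] := pselect (exists i, `|complex.Re z - X i| < 3 / 4).
  exists i => w wz u su; apply: gluingE; have := tri i w; lra.
exists 0%N => w wz u su.
have far i : ~ S i w.
  move=> /SX wi; apply: no; exists i.
  have : `|complex.Re z - X i| <= `|complex.Re z - complex.Re w| + `|complex.Re w - X i|.
    by apply: le_trans (ler_normD _ _); rewrite addrA subrK.
  rewrite [`|complex.Re z - complex.Re w|]distrC; lra.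
have [->|[i [Si _]]] := gluing_cases w su; last by have := far i.
by rewrite su// scale0r.
Qed.

Lemma gluing_near z : exists i, \forall w \near z,
  forall u, supported u -> (u i w : R[i]) *: x i = gluing u w.
Proof.
have [i iP] := gluing_local z; exists i.
apply/nbhs_planeP; exists 4^-1; first by rewrite invr_gt0.
move=> w wz u su; rewrite iP//; apply: le_lt_trans wz.
by apply: le_trans (ler_Re_normc _); case: w z {iP} => ? ? [].
Qed.

(** Off the closed set [S i] the function vanishes on a whole neighbourhood. Hence derived families
    can be glued again, and partial derivatives of every order commute with gluing. *)
Lemma supported_rderive u u' v : supported u ->
  (forall i z, is_rderive v (u i) z (u' i z)) -> supported u'.
Proof.
move=> su du i z nSz; apply: (is_rderive_unique (@plane_hausdorff R) (du i z)).
apply: (@is_rderive_near _ _ (fun=> 0)); last exact: is_rderive_cst.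
have : nbhs z (~` S i) by apply: open_nbhs_nbhs; split=> //; exact: closed_openC.
by apply: filterS => w nSw; rewrite su.
Qed.

Lemma gluing_rderive u u' v z : supported u -> supported u' ->
  (forall i z, is_rderive v (u i) z (u' i z)) ->
  is_rderive v (gluing u) z (gluing u' z).
Proof.
move=> su su' du; have [i iP] := gluing_near z.
apply: (@is_rderive_near _ _ (fun w => (u i w : R[i]) *: x i)).
  by move: iP; apply: filterS => w; exact.
have /= iz := nbhs_singleton iP; rewrite -(iz u' su').
have := is_rderiveM (du i z) (is_rderive_cst v (x i) z).
by rewrite scaler0 addr0.
Qed.

Lemma gluing_continuous u z : supported u -> (forall i z, {for z, continuous (u i)}) ->
  {for z, continuous (gluing u)}.
Proof.
move=> su cu; have [i iP] := gluing_near z.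
have FF : Filter (nbhs z) by exact: nbhs_filter.
have cx : (fun _ : Cplane R => x i) @ nbhs z --> x i by exact: cst_continuous.
have H := @tvs_cvgZ R E (Cplane R) (nbhs z) FF (u i) (fun=> x i) (u i z) (x i) (cu i z) cx.
have /= iz := nbhs_singleton iP; rewrite (iz u su) in H.
rewrite /prop_for /continuous_at; apply: cvg_trans H; apply: near_eq_cvg.
by move: iP; apply: filterS => w /(_ u su).
Qed.

Lemma gluing_dx u u' v : supported u -> (forall i z, is_rderive v (u i) z (u' i z)) ->
  rderive v (gluing u) = gluing u'.
Proof.
move=> su du; apply/funext => z; apply: (rderiveE hE).
by apply: gluing_rderive => //; exact: supported_rderive du.
Qed.

Lemma gluing_Ck D k u A : smooth_family D lam k u -> supported u -> Ck k A (gluing u).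
Proof.
elim: k u => [|k IH] u [_ cu du] su /=.
  by split=> [z _|//]; exact: (gluing_continuous su cu).
case: du => ux [uy [u1 ui sx sy]].
have sux := supported_rderive su u1; have suy := supported_rderive su ui.
split; first by move=> z _; exact: (gluing_continuous su cu).
rewrite /dx /dy (gluing_dx su u1) (gluing_dx su ui).
split; [|exact: IH sx sux|exact: IH sy suy] => z _.
split; [exists (gluing ux z)|exists (gluing uy z)].
  exact: (gluing_rderive su sux u1).
exact: (gluing_rderive su suy ui).
Qed.

Lemma gluing_partial D u al : (forall k, smooth_family D lam k u) -> supported u ->
  exists u', [/\ partial al (gluing u) = gluing u', poly_bounded D lam u' & supported u'].
Proof.
case: al => m n su sp; rewrite /partial /=.
have [v [-> sv spv]] : exists v, [/\ iter n (@dy R E) (gluing u) = gluing v,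
    smooth_family D lam m v & supported v].
  have {su} := su (n + m)%N; elim: n u sp => [|n IH] u sp su; first by exists u.
  case: su => _ _ [ux [uy [u1 ui sx sy]]].
  rewrite iterSr /dy (gluing_dx sp ui); apply: IH sy.
  exact: supported_rderive ui.
elim: m v sv spv => [|m IH] v sv spv.
  by case: sv => bv _ _; exists v.
case: sv => _ _ [ux [uy [u1 ui sx sy]]].
rewrite iterSr /dx (gluing_dx spv u1); apply: IH sx _.
exact: supported_rderive u1.
Qed.

End Glue.

Section GlueKW.
Variables (R : realType) (E : tvsType R[i]).
Hypothesis hE : hausdorff_space E.
Variables (X : nat -> R) (S : nat -> set (Cplane R)) (x : nat -> E) (lam : nat -> R).
Hypothesis lam1 : forall i, 1 <= lam i.
Hypothesis X1 : forall i, 1 <= X i.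
Hypothesis Xsep : forall i j, i != j -> 2 <= `|X i - X j|.
Hypothesis SX : forall i z, S i z -> `|complex.Re z - X i| <= 4^-1.
Hypothesis Sclosed : forall i, closed (S i).
Variables (W : nat -> R -> R) (F G : R -> R) (lvl : nat -> nat) (B : nat -> set E).
Hypothesis hW : weight_system W.
Hypothesis bB : forall n, tvs_bounded (B n).
Hypothesis xB : forall i, B (lvl i) (x i).
Hypothesis Slvl : forall a : R, 0 < a -> a < 1 -> exists n0, forall i z, S i z ->
  closure (strip (fun t => a * F t)%R (fun t => a * G t)%R) z -> (lvl i <= n0)%N.
Implicit Types (u : nat -> Cplane R -> Cplane R) (z w : Cplane R).

(* The square root beats every power of [lam i], and [W i] every fixed weight
   as soon as [i] is large. *)
Definition damping i : R := expR (- (Num.sqrt (lam i) + W i (X i + 1))).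

Lemma weight_leq N i t : 0 <= t -> (N <= i)%N -> W N t <= W i t.
Proof.
move=> t0; elim: i => [|i IH]; first by rewrite leqn0 => /eqP ->.
rewrite leq_eqVlt => /orP[/eqP -> //|]; rewrite ltnS => /IH h.
by apply: le_trans h _; exact: hW.2.
Qed.

Lemma weight_le N s t : 0 <= s -> s <= t -> W N s <= W N t.
Proof. by move=> s0 st; have [_ H _] := hW.1 N; exact: H. Qed.

Lemma poly_sqrt_expR (p : nat) (l : R) : 0 <= l ->
  l ^+ p * expR (- Num.sqrt l) <= (2 * p)`!%:R.
Proof.
move=> l0; rewrite -[in l ^+ p](sqr_sqrtr l0) -exprM expRN ler_pdivrMr ?expR_gt0//.
exact: expR_ge_Xn (sqrtr_ge0 _).
Qed.

(** A seminorm is bounded on each [B n] without uniformity in [n]. For a fixed ratio [a], [Slvl]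
    leaves only the levels up to [n0], so one [M] bounds all the vectors involved; the damping does
    the rest. *)
Lemma gluing_KW u : (forall k, smooth_family S lam k u) -> supported S u ->
  KW W F G (gluing X (fun i => (damping i)%:C *: x i) u).
Proof.
move=> su spu; split.
  by move=> k; exact: (gluing_Ck hE _ Xsep SX Sclosed _ (su k) spu).
move=> p sp cp N al a a0 a1.
have [u' [-> [C [q [C0 Cu]]] spu']] :=
  gluing_partial hE (fun i => (damping i)%:C *: x i) Xsep SX Sclosed al su spu.
have [n0 n0P] := Slvl a0 a1.
have [M M0 pM] : exists2 M : R, 0 <= M & forall i, (lvl i <= n0)%N -> p (x i) <= M.
  have [m mP] := @choice _ _ (fun n (M : R) => 0 < M /\ forall y, B n y -> p y <= M)
    (fun n => let: ex_intro2 M M0 MB := seminorm_bounded sp cp (bB n) in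
      ex_intro _ M (conj M0 MB)).
  exists (\sum_(n < n0.+1) m n); first by apply: sumr_ge0 => n _; exact: ltW (mP n).1.
  move=> i; rewrite -ltnS => il; apply: le_trans ((mP _).2 _ (xB i)) _.
  rewrite (bigD1 (Ordinal il))//= lerDl; apply: sumr_ge0 => n _; exact: ltW (mP n).1.
(* A bound for the i-th piece: its support lies within 1/4 of [X i], so the weight there is at most
   its value at [X i + 1]. *)
pose b i := expR (W N (X i + 1)) * (C * lam i ^+ q * (damping i * M)).
have b0 i : 0 <= b i.
  by rewrite !mulr_ge0 ?expR_ge0// exprn_ge0// (le_trans ler01).
have bN i : (N <= i)%N -> b i <= C * M * (2 * q)`!%:R.
  move=> Ni; have l0 : 0 <= lam i by rewrite (le_trans ler01).
  have -> : b i = C * M * (lam i ^+ q * expR (- Num.sqrt (lam i))) *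
     expR (W N (X i + 1) - W i (X i + 1)).
    by rewrite /b /damping opprD !expRD; ring.
  rewrite -[leRHS]mulr1; apply: ler_pM; rewrite ?expR_ge0//.
  - by rewrite !mulr_ge0 ?expR_ge0// exprn_ge0.
  - by rewrite ler_wpM2l ?mulr_ge0// poly_sqrt_expR.
  - rewrite -expR0 ler_expR subr_le0 weight_leq// addr_ge0//.
    by apply: le_trans (X1 i).
(* The damping contains [W i], which dominates [W N] once [N <= i]; the finitely many earlier pieces
   are simply added. *)
pose K := C * M * (2 * q)`!%:R + \sum_(i < N) b i.
have bK i : b i <= K.
  have [Ni|iN] := leqP N i.
    by apply: le_trans (bN i Ni) _; rewrite lerDl; apply: sumr_ge0.
  rewrite /K (bigD1 (Ordinal iN))//= addrCA lerDl addr_ge0 ?mulr_ge0//.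
  by apply: sumr_ge0.
apply: (@le_lt_trans _ _ K%:E); last exact: ltry.
apply: ge_ereal_sup => _ [z zcl <-]; rewrite lee_fin.
have K0 : 0 <= K by apply: le_trans (b0 0%N) (bK 0%N).
have [->|[i [Sz ->]]] := gluing_cases X (fun i => (damping i)%:C *: x i) z spu'.
  by rewrite seminorm0// mulr0.
apply: le_trans (bK i); apply: ler_pM; rewrite ?expR_ge0 ?seminorm_ge0//.
  rewrite ler_expR; apply: weight_le => //.
  have := SX Sz; have := X1 i; rewrite ler_norml => Xi /andP[h1 h2].
  by rewrite ger0_norm; lra.
rewrite sp.2 sp.2 normc_real ger0_norm ?expR_ge0//.
apply: ler_pM; rewrite ?normc_ge0 ?mulr_ge0 ?expR_ge0 ?seminorm_ge0//.
  exact: Cu.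
by rewrite ler_wpM2l ?expR_ge0// pM// (n0P i z).
Qed.

End GlueKW.

(** * Green's formula on a grid *)

Section RiemannSum.
Variable R : realType.

(** Stands in for a lower bound on the integral of a bump, uniformly in the mesh [d <= del]; the
    part of the plateau to the right of [m] is enough. *)
Lemma riemann_sum_ge (beta : R -> R) (x0 d m del c : R) (q : nat) :
  (forall t, 0 <= beta t) -> 0 < c ->
  (forall t, `|t - m| <= del -> c <= beta t) ->
  0 < d -> d <= del -> x0 <= m -> m + del <= x0 + q%:R * d ->
  c * del <= d * \sum_(0 <= a < q) beta (x0 + a%:R * d).
Proof.
move=> b0 c0 bc d0 ddel xm mq; have del0 : 0 < del := lt_le_trans d0 ddel.
(* The increments of [clip] along the grid are at most [d], vanish off
   the interval [[m, m + del]], and telescope to [del]. *)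
pose clip t := Num.min (Num.max t m) (m + del).
have clipE : clip (x0 + q%:R * d) - clip x0 = del.
  rewrite /clip (max_idPl _); last by lra.
  rewrite (max_idPr _); last by lra.
  rewrite (min_idPr _); last by lra.
  by rewrite (min_idPl _); lra.
have step t : c * (clip (t + d) - clip t) <= d * beta t.
  have := b0 t => bt0; have dbt : 0 <= d * beta t by rewrite mulr_ge0// ltW.
  have [tm|tm] := leP (t + d) m.
    suff -> : clip (t + d) - clip t = 0 by rewrite mulr0.
    rewrite /clip (max_idPr _)// (max_idPr _); last by lra.
    by rewrite subrr.
  have [mt|mt] := leP (m + del) t.
    suff -> : clip (t + d) - clip t = 0 by rewrite mulr0.
    rewrite /clip (max_idPl _); last by lra.
    rewrite (max_idPl _); last by lra.
    by rewrite (min_idPr _) ?(min_idPr _) ?subrr//; lra.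
  have bct : c <= beta t by apply: bc; rewrite ler_norml; apply/andP; split; lra.
  have cl : clip (t + d) - clip t <= d.
    rewrite /clip lerBlDr.
    have [h1|h1] := leP t m; have [h2|h2] := leP (t + d) (m + del).
    - rewrite (max_idPl (ltW tm)) (min_idPl h2) ?(max_idPr h1); first by rewrite (min_idPl _); lra.
    - by lra.
    - by rewrite (max_idPl (ltW tm)) (min_idPl h2) (min_idPl (ltW mt)); lra.
    - by rewrite (max_idPl (ltW tm)) (min_idPr (ltW h2)) (min_idPl (ltW mt)); lra.
  apply: (@le_trans _ _ (c * d)); first by rewrite ler_pM2l.
  by rewrite mulrC ler_pM2l.
have tel : clip (x0 + q%:R * d) - clip x0 =
    \sum_(0 <= a < q) (clip (x0 + a.+1%:R * d) - clip (x0 + a%:R * d)).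
  by rewrite (telescope_sumr (fun a => clip (x0 + a%:R * d)))// mul0r addr0.
rewrite -clipE tel !mulr_sumr; apply: ler_sum_nat => a _.
have := step (x0 + a%:R * d).
by rewrite -addrA -[X in _ + (_ + X)]mul1r -mulrDl natr1.
Qed.

End RiemannSum.

Section Grid.
Variables (R : realType) (E : tvsType R[i]) (BN BK : set E).
Hypotheses (cBN : absolutely_convex BN) (cBK : absolutely_convex BK).
Variables (x0 l1 l2 : R).
Hypotheses (l1p : 0 < l1) (l2p : 0 < l2).

Definition rect : set (Cplane R) :=
  [set z | x0 <= complex.Re z <= x0 + l1 /\ 0 <= complex.Im z <= l2].

Variables (f : Cplane R -> E) (h h' : Cplane R -> Cplane R) (Ch : R).
Variables (fx fy : Cplane R -> E).
Hypothesis fBK : forall z, rect z -> [/\ BK (f z), BK (fx z) & BK (fy z)].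
Hypothesis fBN : forall z, rect z -> complex.Im z = 0 -> BN (f z).

(** Smoothness of [f] enters the grid computation only in this form: normalised second-order
    remainders in one absolutely convex set, so that errors are added up without any limit in
    [E]. *)
Definition taylor2 (u : Cplane R) (g : Cplane R -> E) := forall z t, rect z -> 0 < t ->
  rect (z + t%:C * u) ->
  BK ((t ^- 2)%:C *: (f (z + t%:C * u) - f z - t%:C *: g z)).
Hypotheses (fxT : taylor2 1 fx) (fyT : taylor2 'i%C fy).

Hypothesis hC : forall z, rect z -> normc (h z : R[i]) <= Ch /\ normc (h' z : R[i]) <= Ch.
Hypothesis hT : forall (u : Cplane R) z t, normc (u : R[i]) = 1 -> (u = 1 \/ u = 'i%C) ->
  rect z -> 0 < t -> rect (z + t%:C * u) ->
  normc (h (z + t%:C * u) - h z - t%:C * (u * h' z) : R[i]) <= Ch * t ^+ 2.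

Let U z : E := (h z : R[i]) *: f z.
Let C3 := Ch * (3 + l1 + l2).

Lemma Ch_ge0 : 0 <= Ch.
Proof.
have r0 : rect (x0 +i* 0) by rewrite /rect /= !lexx /= lerDl !ltW.
exact: le_trans (normc_ge0 _) (hC r0).1.
Qed.

Lemma grid_step (u : Cplane R) (g : Cplane R -> E) z t : u = 1 \/ u = 'i%C ->
  taylor2 u g -> (forall z, rect z -> BK (g z)) ->
  rect z -> 0 < t -> t <= l1 + l2 -> rect (z + t%:C * u) ->
  exists2 r, U (z + t%:C * u) - U z =
    t%:C *: ((h z : R[i]) *: g z + (u * h' z : R[i]) *: f z) + r
    & scaled (C3 * t ^+ 2) BK r.
Proof.
move=> u1 gT gBK rz t0 tl rzt.
have nu : normc (u : R[i]) = 1 by case: u1 => ->; rewrite ?normc1 ?normci.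
have t2 : 0 < t ^+ 2 by rewrite exprn_gt0.
set zt := z + _ in rzt *; pose b := (t ^- 2)%:C *: (f zt - f z - t%:C *: g z).
have bB : BK b by exact: gT.
pose e : R[i] := h zt - h z - t%:C * (u * h' z).
have ee : normc e <= Ch * t ^+ 2 by exact: hT.
have fzt : f zt = f z + t%:C *: g z + (t ^+ 2)%:C *: b.
  rewrite /b scalerA -rmorphM/= divff ?gt_eqF// scale1r.
  by rewrite [RHS]addrC -(addrA (f zt)) -opprD subrK.
have hzt : h zt = h z + t%:C * (u * h' z) + e :> R[i] by rewrite /e; ring.
have l10 := ltW l1p; have l20 := ltW l2p.
have [hz1 hz2] := hC rz; have [hzt1 _] := hC rzt.
have Ch0 := Ch_ge0; have ct : 0 <= Ch * t ^+ 2 by rewrite mulr_ge0// ltW.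
(* What remains of the product rule: the remainder of [f], the increment of [h] against that of [f],
   and the remainder of [h]. They cost [Ch], [Ch * (1 + l1 + l2)] and [Ch] times [t ^+ 2], which sum
   to [C3 * t ^+ 2]. *)
exists ((h zt * (t ^+ 2)%:C : R[i]) *: b + ((h zt - h z) * t%:C : R[i]) *: g z + e *: f z).
  clearbody b.
  have gen (Y1 Y2 Y3 Y4 Y5 : E) : Y1 + Y2 + (Y3 + Y4 + Y5) = (Y2 + Y5) + (Y1 + Y4) + Y3.
    by rewrite [Y3 + Y4]addrC [Y4 + Y3 + Y5]addrAC addrA addrACA [Y1 + Y4 + _]addrC.
  rewrite /U fzt !scalerDr !scalerA addrAC [X in X + _ = _]addrAC -scalerBl.
  by rewrite [RHS]gen -!scalerDl; congr (_ *: _ + _ *: _ + _); rewrite /e; ring.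
have -> : C3 * t ^+ 2 = Ch * t ^+ 2 + (Ch * t ^+ 2 * (1 + (l1 + l2))) + Ch * t ^+ 2.
  by rewrite /C3; ring.
have sc1 y : BK y -> scaled 1 BK y by move=> By; exists y => //; rewrite scale1r.
apply: scaledD => //.
- by rewrite addr_ge0// mulr_ge0// !addr_ge0.
- apply: scaledD => //.
  + by rewrite mulr_ge0// !addr_ge0.
  + apply: (@scaledZ _ _ _ _ 1) => //; last exact: sc1.
    by rewrite mulr1 normcM normc_real (ger0_norm (ltW t2)) ler_wpM2r// ltW.
  + apply: (@scaledZ _ _ _ _ 1) => //; last exact/sc1/gBK.
    rewrite mulr1 normcM normc_real (ger0_norm (ltW t0)).
    have -> : h zt - h z = t%:C * (u * h' z) + e by rewrite /e; ring.
    have : normc (t%:C * (u * h' z) + e) <= t * Ch + Ch * t ^+ 2.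
      apply: le_trans (ler_normcD _ _) _; apply: lerD => //.
      by rewrite !normcM nu mul1r normc_real (ger0_norm (ltW t0)) ler_wpM2l// ltW.
    move=> /(ler_wpM2r (ltW t0)) /le_trans; apply.
    have -> : (t * Ch + Ch * t ^+ 2) * t = Ch * t ^+ 2 * (1 + t) by ring.
    by rewrite ler_wpM2l ?lerD2l// mulr_ge0// ltW.
- apply: (@scaledZ _ _ _ _ 1) => //; last by apply: sc1; case: (fBK rz).
  by rewrite mulr1.
Qed.

Variables (rho : Cplane R -> R) (v : E).
Hypothesis feq : forall z, rect z ->
  (h z : R[i]) *: (fx z + 'i%C *: fy z) = (rho z)%:C *: v.
Variable M1 : R.
Hypothesis M10 : 0 <= M1.
Hypothesis hbot : forall z, rect z -> complex.Im z = 0 -> normc (h z : R[i]) <= 1.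
Hypothesis hside : forall z, rect z ->
  complex.Im z = l2 \/ complex.Re z = x0 \/ complex.Re z = x0 + l1 ->
  normc (h z : R[i]) <= M1.

Definition gridpt (q a b : nat) : Cplane R :=
  (x0 + a%:R * (l1 / q%:R)) +i* (0 + b%:R * (l2 / q%:R)).

(** On each cell, [dy] times the horizontal increment of h f plus ['i dx] times the vertical one
    equals, up to third order, [dx dy] times h (fx + i fy), that is [dx dy rho v]. Summed over the
    grid, the increments telescope to the four sides. *)
Lemma grid_green q : (0 < q)%N ->
  exists yN yK, [/\
    (l1 / q%:R * (l2 / q%:R) * \sum_(0 <= a < q) \sum_(0 <= b < q) rho (gridpt q a b))%:C *: v
      = yN + yK,
    scaled l1 BN yN &
    scaled ((l1 + 2 * l2) * M1 + l1 * l2 * (l1 + l2) * C3 / q%:R) BK yK].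
Proof.
move=> q0; have qp : 0 < q%:R :> R by rewrite ltr0n.
set dx := l1 / q%:R; set dy := l2 / q%:R.
have dx0 : 0 < dx by rewrite divr_gt0.
have dy0 : 0 < dy by rewrite divr_gt0.
have qdx : q%:R * dx = l1 by rewrite mulrC divfK// gt_eqF.
have qdy : q%:R * dy = l2 by rewrite mulrC divfK// gt_eqF.
have q1 : 1 <= q%:R :> R by rewrite ler1n.
have dxl : dx <= l1 by rewrite ler_pdivrMr// ler_peMr// ltW.
have dyl : dy <= l2 by rewrite ler_pdivrMr// ler_peMr// ltW.
have Ch0 := Ch_ge0.
have l10 := ltW l1p; have l20 := ltW l2p.
have [c cE] := ex_intro (fun c => c = C3) C3 erefl.
have c0 : 0 <= c by rewrite cE mulr_ge0// !addr_ge0// ltW.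
rewrite -cE.
have rg a b : (a <= q)%N -> (b <= q)%N -> rect (gridpt q a b).
  move=> aq bq; rewrite /rect /gridpt /= -/dx -/dy.
  have ax : 0 <= a%:R * dx <= l1.
    by rewrite mulr_ge0 ?ler0n ?(ltW dx0)//= -qdx ler_pM2r// ler_nat.
  have bx : 0 <= b%:R * dy <= l2.
    by rewrite mulr_ge0 ?ler0n ?(ltW dy0)//= -qdy ler_pM2r// ler_nat.
  by split; lra.
have gx a b : gridpt q a.+1 b = gridpt q a b + dx%:C * 1.
  rewrite /gridpt -/dx -/dy -natr1 mulrDl mul1r; apply/eqP; rewrite eq_complex /=.
  by apply/andP; split; apply/eqP; ring.
have gy a b : gridpt q a b.+1 = gridpt q a b + dy%:C * 'i%C.
  rewrite /gridpt -/dx -/dy -natr1 mulrDl mul1r; apply/eqP; rewrite eq_complex /=.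
  by apply/andP; split; apply/eqP; ring.
pose V a b := U (gridpt q a b).
have BK0 : BK !=set0 by exists (f (gridpt q 0 0)); case: (fBK (rg 0%N 0%N isT isT)).
have BN0 : BN !=set0.
  by exists (f (gridpt q 0 0)); apply: fBN; [exact: rg|rewrite /gridpt /= mul0r addr0].
pose rem a b := dy%:C *: (V a.+1 b - V a b) + (dx%:C * 'i%C) *: (V a b.+1 - V a b)
  - (dx * dy * rho (gridpt q a b))%:C *: v.
have remB a b : (a < q)%N -> (b < q)%N -> scaled (c * (dx * dy * (dx + dy))) BK (rem a b).
  move=> aq bq; have rz := rg _ _ (ltnW aq) (ltnW bq).
  have rx := rg _ _ aq (ltnW bq); have ry := rg _ _ (ltnW aq) bq.
  have [r1 r1E r1B] := @grid_step 1 fx (gridpt q a b) dx (or_introl erefl) fxT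
    (fun z rz => let: And3 _ B1 _ := fBK rz in B1) rz dx0 ltac:(by lra)
    ltac:(by rewrite -gx).
  have [r2 r2E r2B] := @grid_step 'i%C fy (gridpt q a b) dy (or_intror erefl) fyT
    (fun z rz => let: And3 _ _ B1 := fBK rz in B1) rz dy0 ltac:(by lra)
    ltac:(by rewrite -gy).
  rewrite -cE in r1B r2B.
  have -> : rem a b = dy%:C *: r1 + (dx%:C * 'i%C) *: r2.
    (* Holomorphy of [h] is used here: its derivatives along 1 and 'i are [h'] and ['i h'], so the
       terms in [f] carry the factor 1 + 'i^2 = 0. *)
    have key : dy%:C *: (dx%:C *: ((h (gridpt q a b) : R[i]) *: fx (gridpt q a b) +
          (1 * h' (gridpt q a b) : R[i]) *: f (gridpt q a b))) +
        (dx%:C * 'i%C) *: (dy%:C *: ((h (gridpt q a b) : R[i]) *: fy (gridpt q a b) +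
          ('i%C * h' (gridpt q a b) : R[i]) *: f (gridpt q a b))) =
        (dx * dy * rho (gridpt q a b))%:C *: v.
      have -> : (dx * dy * rho (gridpt q a b))%:C = (dx * dy)%:C * (rho (gridpt q a b))%:C :> R[i].
        by rewrite [LHS]rmorphM.
      rewrite -[RHS]scalerA -(feq rz) !scalerDr !scalerA addrACA -scalerDl.
      rewrite [X in _ + X *: f _](_ : _ =
        (dx%:C * dy%:C) * h' (gridpt q a b) * (1 + 'i%C ^+ 2)); last by ring.
      rewrite sqr_i subrr mulr0 scale0r addr0 [(dx * dy)%:C]rmorphM.
      by congr (_ *: _ + _ *: _); ring.
    have gen (c' d : R[i]) (P Q s1 s2 : E) :
        c' *: (P + s1) + d *: (Q + s2) - (c' *: P + d *: Q) = c' *: s1 + d *: s2.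
      by rewrite !scalerDr addrACA [LHS]addrAC subrr add0r.
    rewrite /rem /V gx gy r1E r2E -key; exact: gen.
  have -> : c * (dx * dy * (dx + dy)) = dy * (c * dx ^+ 2) + dx * (c * dy ^+ 2).
    by ring.
  have t1 : 0 <= c * dx ^+ 2 by apply: mulr_ge0 => //; exact/exprn_ge0/ltW.
  have t2 : 0 <= c * dy ^+ 2 by apply: mulr_ge0 => //; exact/exprn_ge0/ltW.
  apply: scaledD => //; [exact: mulr_ge0 (ltW dy0) t1|exact: mulr_ge0 (ltW dx0) t2| |].
    apply: scaledZ r1B => //.
    by rewrite normc_real ger0_norm// ltW.
  apply: scaledZ r2B => //.
  by rewrite normcM normci mulr1 normc_real ger0_norm// ltW.
pose Rem := \sum_(0 <= a < q) \sum_(0 <= b < q) rem a b.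
have RemB : scaled (l1 * l2 * (l1 + l2) * c / q%:R) BK Rem.
  (* There are q^2 cells with an error of order q^-3 each. *)
  have -> : l1 * l2 * (l1 + l2) * c / q%:R = q%:R * (q%:R * (c * (dx * dy * (dx + dy)))).
    by rewrite -qdx -qdy; field; rewrite gt_eqF.
  rewrite /Rem big_mkord; apply: scaled_sum => //.
    by rewrite !mulr_ge0// ?addr_ge0// ltW.
  move=> a; rewrite big_mkord; apply: scaled_sum => //.
    by rewrite !mulr_ge0// ?addr_ge0// ltW.
  by move=> b; exact: remB.
have sc1 (B : set E) y : B y -> scaled 1 B y by move=> By; exists y => //; rewrite scale1r.
have VK a b : (a <= q)%N -> (b <= q)%N -> (b == q) || (a == 0%N) || (a == q) ->
    scaled M1 BK (V a b).
  move=> aq bq ab; rewrite /V /U; apply: (@scaledZ _ _ _ _ 1) => //; last first.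
    by apply: sc1; case: (fBK (rg a b aq bq)).
  rewrite mulr1; apply: hside; first exact: rg.
  rewrite /gridpt /= -/dx -/dy add0r.
  case/orP: ab => [/orP[/eqP ->|/eqP ->]|/eqP ->]; first by left.
    by right; left; rewrite mul0r addr0.
  by right; right; rewrite qdx.
(* The bottom side alone goes to [BN]; the other three sides and the accumulated error go to
   [BK]. *)
exists (- ((dx%:C * 'i%C) *: \sum_(0 <= a < q) V a 0%N)).
exists (dy%:C *: (\sum_(0 <= b < q) V q b) - dy%:C *: (\sum_(0 <= b < q) V 0%N b)
   + (dx%:C * 'i%C) *: (\sum_(0 <= a < q) V a q) - Rem); split.
- have RemE : Rem = dy%:C *: (\sum_(0 <= b < q) V q b - \sum_(0 <= b < q) V 0%N b) +
     (dx%:C * 'i%C) *: (\sum_(0 <= a < q) V a q - \sum_(0 <= a < q) V a 0%N) -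
     (dx * dy * \sum_(0 <= a < q) \sum_(0 <= b < q) rho (gridpt q a b))%:C *: v.
    rewrite /Rem /rem.
    have -> : \sum_(0 <= a < q) \sum_(0 <= b < q) (dy%:C *: (V a.+1 b - V a b) +
        (dx%:C * 'i%C) *: (V a b.+1 - V a b) - (dx * dy * rho (gridpt q a b))%:C *: v) =
       \sum_(0 <= a < q) \sum_(0 <= b < q) dy%:C *: (V a.+1 b - V a b) +
       \sum_(0 <= a < q) \sum_(0 <= b < q) (dx%:C * 'i%C) *: (V a b.+1 - V a b) -
       \sum_(0 <= a < q) \sum_(0 <= b < q) (dx * dy * rho (gridpt q a b))%:C *: v.
      rewrite -big_split -sumrB; apply: eq_bigr => a _ /=.
      by rewrite -big_split -sumrB; apply: eq_bigr.
    congr (_ + _ - _).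
    + rewrite exchange_big_nat/= -sumrB scaler_sumr; apply: eq_bigr => b _.
      by rewrite -scaler_sumr (telescope_sumr (fun a => V a b)).
    + rewrite -sumrB scaler_sumr; apply: eq_bigr => a _.
      by rewrite -scaler_sumr (telescope_sumr (fun b => V a b)).
    + rewrite mulr_sumr rmorph_sum scaler_suml; apply: eq_bigr => a _.
      by rewrite mulr_sumr rmorph_sum scaler_suml.
  have gen (P c3 c4 c5 : E) : c5 = - c4 + (P + c3 - (P + (c3 - c4) - c5)).
    rewrite opprB (addrA P c3) opprB (addrC c5) [X in _ + X]addrA.
    by rewrite [P + c3 + _]addrC subrK addKr.
  rewrite RemE !scalerBr; exact: gen.
- rewrite -scaleNr; apply: (@scaledZ _ _ _ _ (q%:R * 1)) => //.
    by rewrite normc_opp normcM normci !mulr1 normc_real (ger0_norm (ltW dx0)) mulrC qdx.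
  rewrite big_mkord; apply: scaled_sum => // a; rewrite /V /U.
  have rz := rg a 0%N (ltnW (ltn_ord a)) isT.
  have im0 : complex.Im (gridpt q a 0) = 0 by rewrite /gridpt /= mul0r addr0.
  apply: (@scaledZ _ _ _ _ 1) => //; last by apply: sc1; exact: fBN.
  by rewrite mulr1; exact: hbot.
- have -> : (l1 + 2 * l2) * M1 + l1 * l2 * (l1 + l2) * c / q%:R =
     (l2 * M1 + l2 * M1) + l1 * M1 + l1 * l2 * (l1 + l2) * c / q%:R by ring.
  have l1M : 0 <= l1 * M1 by rewrite mulr_ge0// ltW.
  have l2M : 0 <= l2 * M1 by rewrite mulr_ge0// ltW.
  have qM : 0 <= q%:R * M1 by rewrite mulr_ge0.
  have dyS (c' : R[i]) g : normc c' = dy -> (forall b, (b < q)%N -> scaled M1 BK (g b)) ->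
      scaled (l2 * M1) BK (c' *: \sum_(0 <= b < q) g b).
    move=> cd gB; apply: (@scaledZ _ _ _ _ (q%:R * M1)) => //.
      by rewrite cd mulrA [dy * _]mulrC qdy.
    by rewrite big_mkord; apply: scaled_sum => // b; exact: gB.
  have rem0 : 0 <= l1 * l2 * (l1 + l2) * c / q%:R.
    by rewrite !mulr_ge0 ?addr_ge0 ?invr_ge0 ?(ltW l1p) ?(ltW l2p) ?(ltW qp).
  apply: scaledD => //; first by rewrite !addr_ge0.
    apply: scaledD => //; first by rewrite addr_ge0.
      apply: scaledD => //.
        apply: dyS; first by rewrite normc_real ger0_norm// ltW.
        by move=> b bq; apply: VK; rewrite ?leqnn ?(ltnW bq) ?eqxx ?orbT.
      rewrite -scaleNr; apply: dyS.
        by rewrite normc_opp normc_real ger0_norm// ltW.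
      by move=> b bq; apply: VK; rewrite ?leq0n ?(ltnW bq) ?eqxx ?orbT.
    apply: (@scaledZ _ _ _ _ (q%:R * M1)) => //.
      by rewrite normcM normci mulr1 normc_real (ger0_norm (ltW dx0)) mulrA [dx * _]mulrC qdx.
    rewrite big_mkord; apply: scaled_sum => // b; apply: VK; rewrite ?leqnn ?eqxx//.
    exact: ltnW.
  rewrite -scaleN1r; apply: scaledZ RemB => //.
  by rewrite normc_opp normc1 mul1r.
Qed.

End Grid.

(** * Condition (A) in exponential form *)

Section ConditionA.
Variables (R : realType) (E : tvsType R[i]) (B : nat -> set E).
Hypothesis hB : fundamental_bounded_sequence B.

Lemma fundamental_le m k : (m <= k)%N -> B m `<=` B k.
Proof.
have [_ h _] := hB; elim: k => [|k IH]; first by rewrite leqn0 => /eqP ->.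
rewrite leq_eqVlt => /orP[/eqP -> //|]; rewrite ltnS => /IH mk x /mk; exact: h.
Qed.

Lemma fundamental_cvx m : absolutely_convex (B m).
Proof. by have [h _ _] := hB; case: (h m). Qed.

(* With [r = e^t], the inclusion required by (A) reads [splits]. *)
Definition splits (n k : nat) (t s : R) (x : E) := exists yn yk,
  [/\ x = yn + yk, scaled (expR t) (B n) yn & scaled (expR (- (s * t))) (B k) yk].

Definition interpolates (n : nat) (s : R) := forall m, (n <= m)%N ->
  exists k T, [/\ (m <= k)%N, 0 <= T &
    forall t x, T <= t -> B m x -> splits n k t s x].

(* Splitting first [x] at [t - 1], then its [B k] part at [(1 + s) (t - 1)],
   improves the exponent from [s] to almost [s (2 + s)]; hence one exponent
   yields all of them. *)
Lemma interpolates_double n s : 0 < s -> interpolates n s -> interpolates n (2 * s).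
Proof.
move=> s0 P m nm; have [k [T [mk T0 hk]]] := P m nm.
have [l [T' [kl T'0 hl]]] := P k (leq_trans nm mk).
have ss : 0 <= (2 + s) / s by rewrite divr_ge0// ?addr_ge0// ltW.
(* The last summand ensures s t >= 2 + s, which is what s (2 + s) (t - 1) >= 2 s t amounts to. *)
exists l, (T + T' + 1 + (2 + s) / s); split; first exact: leq_trans kl.
  by rewrite !addr_ge0.
(* The shift by 1 absorbs the sum of two elements of e^t' B_n, because 2 <= e. *)
move=> t x tT Bx; pose t' := t - 1.
have t'0 : 0 <= t' by rewrite /t'; lra.
have [yn [yk [xE [zn Bzn ynE] [zk Bzk ykE]]]] := hk t' x ltac:(by rewrite /t'; lra) Bx.
have st' : t' <= (1 + s) * t' by rewrite ler_peMl// lerDl ltW.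
have [wn [wl [zE wnB wlB]]] := hl ((1 + s) * t') zk
  ltac:(by apply: le_trans st'; rewrite /t'; lra) Bzk.
exists (yn + (expR (- (s * t')))%:C *: wn), ((expR (- (s * t')))%:C *: wl); split.
- by rewrite -addrA -scalerDr -zE ykE.
- apply: (@scaled_le _ _ _ (expR t' + expR t')); first exact: fundamental_cvx.
  + by rewrite addr_ge0 ?expR_ge0.
  + have -> : t = t' + 1 by rewrite /t'; lra.
    have e1 : 2 <= expR (1 : R) by have := expR_ge1Dx (1 : R); lra.
    rewrite [leRHS]expRD; apply: le_trans (ler_wpM2l (expR_ge0 t') e1).
    by rewrite mulr_natr mulr2n.
  + apply: scaledD; rewrite ?expR_ge0//; first exact: fundamental_cvx.
      by exists zn.
    apply: scaledZ wnB; rewrite ?expR_ge0//; first exact: fundamental_cvx.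
    rewrite normc_real ger0_norm ?expR_ge0// -expRD ler_expR; lra.
- apply: scaledZ wlB; rewrite ?expR_ge0//; first exact: fundamental_cvx.
  rewrite normc_real ger0_norm ?expR_ge0// -expRD ler_expR.
  have : (2 + s) / s <= t by lra.
  rewrite ler_pdivrMr// /t' => h.
  have : s * (2 + s) <= s * (t * s) by rewrite ler_wpM2l// ltW.
  by lra.
Qed.

Lemma interpolates_le n s s' : s' <= s -> interpolates n s -> interpolates n s'.
Proof.
move=> ss P m nm; have [k [T [mk T0 hk]]] := P m nm; exists k, T; split=> // t x tT Bx.
have [yn [yk [xE ynB ykB]]] := hk t x tT Bx; exists yn, yk; split=> //.
apply: scaled_le ykB; rewrite ?expR_ge0//; first exact: fundamental_cvx.
by rewrite ler_expR lerN2 ler_wpM2r// (le_trans T0).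
Qed.

Lemma interpolates_all n s s' : 0 < s -> interpolates n s -> interpolates n s'.
Proof.
move=> s0 P; have P2 j : interpolates n (2 ^+ j * s).
  elim: j => [|j IH]; first by rewrite expr0 mul1r.
  by rewrite exprS -mulrA; apply: interpolates_double => //; rewrite mulr_gt0// exprn_gt0.
apply: interpolates_le (P2 (Num.truncn (`|s'| / s)).+1).
rewrite -ler_pdivrMr//; apply: (@le_trans _ _ (`|s'| / s)).
  by rewrite ler_pM2r ?invr_gt0// ler_norm.
have := truncnS_gt (`|s'| / s); move=> /ltW /le_trans; apply.
by rewrite -natrX ler_nat ltnW// ltn_expl.
Qed.

(** For r >= e^T the splitting at t = ln r applies. For smaller r the constant e^(s' T) makes C /
    r^s' at least 1, so [x] itself serves as the component in [B k]. *)
Lemma interpolates_condition_A n s : 0 < s -> B n !=set0 -> interpolates n s ->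
  condition_A B.
Proof.
move=> s0 [b Bb] P; exists n => m s' nm s'0.
have [k [T [mk T0 hk]]] := interpolates_all s' s0 P nm.
have C1 : 1 <= expR (s' * T) by rewrite -expR0 ler_expR mulr_ge0// ltW.
have Bn0 : B n 0.
  rewrite -(addr0 0) -{1}(scale0r b) -(scale0r b); apply: fundamental_cvx => //.
  by rewrite normc0 addr0 ler01.
exists k, (expR (s' * T)); split=> //; first exact: expR_gt0.
move=> r r0 x Bx; have rE : r = expR (ln r) by rewrite lnK.
have rs : expR (s' * T) / r `^ s' = expR (s' * T - s' * ln r).
  by rewrite {1}rE -expRM [ln r * s']mulrC expRD expRN.
rewrite rs; have [Tr|rT] := leP T (ln r).
  have [yn [yk [-> [zn Bzn <-] ykB]]] := hk _ x Tr Bx.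
  rewrite -rE; exists zn => //.
  have [zk Bzk <-] : scaled (expR (s' * T - s' * ln r)) (B k) yk.
    apply: scaled_le ykB; rewrite ?expR_ge0//; first exact: fundamental_cvx.
    by rewrite ler_expR lerDr mulr_ge0// ltW.
  by exists zk.
exists 0 => //; have [zk Bzk xE] : scaled (expR (s' * T - s' * ln r)) (B k) x.
  apply: (@scaled_le _ _ _ 1) => //; first exact: fundamental_cvx.
    by rewrite -expR0 ler_expR -mulrBr mulr_ge0 ?(ltW s'0)// subr_ge0 ltW.
  by exists x; [exact: fundamental_le Bx|rewrite scale1r].
by exists zk => //; rewrite scaler0 add0r.
Qed.

(** The order of the quantifiers matters: [m] precedes [k] and [T], so all vectors of one level come
    from a single bounded set while [k] and [T] vary with the centre. *)
Lemma not_condition_A : ~ condition_A B -> forall n s, 0 < s ->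
  exists m, forall k T, exists t x, [/\ T <= t, B m x & ~ splits n k t s x].
Proof.
move=> nA n s s0; have [_ _ hb] := hB.
(* Nothing prevents the first sets of a fundamental sequence from being empty. *)
have [Bn|/set0P/negP/negPn/eqP Bn] := pselect (B n !=set0); last first.
  have [m Bm] : exists m, [set 0 : E] `<=` B m.
    apply: hb; apply: tvs_bounded_seminorm => p sp _; exists 0 => _ ->.
    by rewrite seminorm0.
  exists m => k T; exists T, 0; split=> //; first exact: Bm.
  by move=> [yn [yk [_ [zn]]]]; rewrite Bn.
have nP : ~ interpolates n s by move=> P; apply: nA; exact: interpolates_condition_A P.
have [m hm] : exists m, ~ ((n <= m)%N -> exists k T, [/\ (m <= k)%N, 0 <= T &
    forall t x, T <= t -> B m x -> splits n k t s x]).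
  by apply: contrapT => h; apply: nP => m; apply: contrapT => h'; apply: h; exists m.
exists m => k T; apply: contrapT => h; apply: hm => nm.
exists (maxn k m), (Num.max T 0); split; first exact: leq_maxr.
  by rewrite le_max lexx orbT.
move=> t x; rewrite ge_max => /andP[Tt t0] Bx.
have : splits n k t s x.
  by apply: contrapT => h'; apply: h; exists t, x.
move=> [yn [yk [xE ynB [zk Bzk ykE]]]]; exists yn, yk; split=> //; exists zk => //.
exact: fundamental_le (leq_maxl _ _) _ Bzk.
Qed.

End ConditionA.

(** * Geometry of the strip *)

Section StripGeometry.
Variable R : realType.
Implicit Types (F G : R -> R) (z : Cplane R).

Lemma calF_bounds F : calF F -> exists FI FS, 0 < FI /\ forall t, FI <= F t <= FS.
Proof.
move=> [_ _ hi hs].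
have le_inf t : (ereal_inf [set (F t)%:E | t in setT] <= (F t)%:E)%E.
  by apply: ereal_inf_lbound; exists t.
have le_sup t : ((F t)%:E <= ereal_sup [set (F t)%:E | t in setT])%E.
  by apply: ereal_sup_ubound; exists t.
move: hi hs le_inf le_sup.
case: (ereal_inf _) => [a||] //; last by move=> _ _ /(_ 0); rewrite leye_eq.
case: (ereal_sup _) => [b||] //; last by move=> _ _ _ /(_ 0); rewrite leeNy_eq.
rewrite lte_fin => a0 _ ha hb; exists a, b; split=> // t.
by rewrite -!lee_fin ha hb.
Qed.

Lemma calF_unif F : calF F -> forall e, 0 < e -> exists2 d, 0 < d &
  forall x y, `|x - y| < d -> `|F x - F y| < e.
Proof.
move=> [uF _ _ _] e e0.
have : entourage [set xy : R * R | ball (F xy.1) e (F xy.2)].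
  exact: (uF _ (entourage_ball _ (PosNum e0))).
rewrite -entourage_ballE => -[d /= d0 dP]; exists d => // x y xy.
by have := dP (x, y); rewrite /= -ball_normE /=; exact.
Qed.

Lemma calF_continuous F : calF F -> continuous F.
Proof.
move=> hF x; apply/cvgrPdist_lt => e e0.
have [d d0 dP] := calF_unif hF e0.
by apply/nbhs_ballP; exists d => // y /dP.
Qed.

Lemma closure_strip_le F G z : continuous F -> closure (strip F G) z ->
  complex.Im z <= F (complex.Re z).
Proof.
move=> cF.
have cl : closed [set w : Cplane R | complex.Im w - F (complex.Re w) <= 0].
  have cf (w : Cplane R) : (fun w => complex.Im w - F (complex.Re w)) @ nbhs w -->
      complex.Im w - F (complex.Re w).
    have im : complex.Im w0 @[w0 --> nbhs w] --> complex.Im w by exact: Im_continuous.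
    have h : F (complex.Re w0) @[w0 --> nbhs w] --> F (complex.Re w).
      by apply: (@continuous_comp _ _ _ (@complex.Re R : Cplane R -> R) F); [exact: Re_continuous|exact: cF].
    by apply: cvgB.
  exact: (closed_comp (fun w _ => cf w) (@closed_le R 0)).
move=> zcl; rewrite -subr_le0; apply: cl; move: z zcl; apply: closure_subset => z /= /andP[_ zF].
by rewrite subr_le0 ltW.
Qed.

(** The lower limit is obtained as the supremum of the constants that are eventually below [F]. *)
Lemma liminf_exists F FI FS : 0 < FI -> (forall t, FI <= F t <= FS) ->
  exists l, [/\ 0 < l,
    (forall e, 0 < e -> exists x, forall y, x <= y -> l - e < F y) &
    (forall e x, 0 < e -> exists2 y, x <= y & F y < l + e)].
Proof.
move=> FI0 FB; pose S := [set c | exists x, forall y, x <= y -> c <= F y].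
have SI : S FI by exists 0 => y _; case/andP: (FB y).
have hS : has_sup S.
  split; first by exists FI.
  exists FS => c [x /(_ x (lexx _)) cx]; apply: le_trans cx _; by case/andP: (FB x).
exists (sup S); split.
- by apply: lt_le_trans FI0 _; apply: ub_le_sup => //; exact: hS.2.
- move=> e e0; have [c [x cx] ec] := sup_adherent e0 hS.
  by exists x => y /cx; exact: lt_le_trans.
- move=> e x e0; apply: contrapT => h.
  have : S (sup S + e).
    exists x => y xy; rewrite leNgt; apply/negP => Fy; apply: h; by exists y.
  by move=> /(ub_le_sup hS.2); rewrite gerDl leNgt e0.
Qed.

Lemma separated_sequence (P : nat -> R -> Prop) (d : R) : 0 < d ->
  (forall i x, exists2 y, x <= y & P i y) ->
  exists X : nat -> R, [/\ forall i, P i (X i), forall i, 1 <= X i &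
    forall i j, i != j -> d <= `|X i - X j|].
Proof.
move=> d0 hP.
have [p pP] := @choice _ _ (fun (ix : nat * R) y => ix.2 <= y /\ P ix.1 y)
  (fun ix => let: ex_intro2 y h1 h2 := hP ix.1 ix.2 in ex_intro _ y (conj h1 h2)).
pose X := fix X i := if i is j.+1 then p (i, X j + d) else p (0%N, 1).
have X_S i : X i + d <= X i.+1 by exact: (pP (i.+1, X i + d)).1.
have Xlt i j : (i < j)%N -> X i + d <= X j.
  elim: j => // j IH; rewrite ltnS leq_eqVlt => /orP[/eqP -> //|/IH h].
  by apply: le_trans h _; apply: le_trans (X_S j); rewrite lerDl ltW.
exists X; split.
- by case=> [|i]; [exact: (pP (0%N, 1)).2|exact: (pP (i.+1, X i + d)).2].
- elim=> [|i IH]; first exact: (pP (0%N, 1)).1.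
  by apply: le_trans IH _; apply: le_trans (X_S i); rewrite lerDl ltW.
- move=> i j; rewrite neq_ltn => /orP[/Xlt h|/Xlt h].
    by rewrite distrC; apply: le_trans (ler_norm _); lra.
  by apply: le_trans (ler_norm _); lra.
Qed.

(** The 2-adic valuation of i + 1, an explicit map that takes every value infinitely often. *)
Definition level (i : nat) := logn 2 i.+1.

Lemma level_infinite n K : exists2 i, (K <= i)%N & level i = n.
Proof.
exists (2 ^ n * (2 * K).+1).-1; last first.
  rewrite /level prednK ?muln_gt0 ?expn_gt0// lognM ?expn_gt0//.
  rewrite pfactorK// lognE/= dvdn2 /= mul2n odd_double /=.
  by rewrite addn0.
rewrite -ltnS prednK ?muln_gt0 ?expn_gt0//.
apply: (@leq_trans (1 * (2 * K).+1)); last by rewrite leq_mul2r expn_gt0 orbT.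
by rewrite mul1n ltnS leq_pmull.
Qed.

End StripGeometry.

Section KWBounds.
Variables (R : realType) (E : tvsType R[i]).
Variables (W : nat -> R -> R) (F G : R -> R) (f : Cplane R -> E).
Hypotheses (hW : weight_system W) (hf : KW W F G f).

Lemma KW_seminorm_bounded p al a : seminorm p -> continuous p -> 0 < a -> a < 1 ->
  exists2 M, 0 <= M & forall z,
    closure (strip (fun t => a * F t)%R (fun t => a * G t)%R) z -> p (partial al f z) <= M.
Proof.
move=> sp cp a0 a1; have := hf.2 p sp cp 0%N al a a0 a1.
set S := ereal_sup _ => S_oo.
have le_S z : closure (strip (fun t => a * F t)%R (fun t => a * G t)%R) z ->
    ((p (partial al f z))%:E <= S)%E.
  move=> zcl; apply: (@le_trans _ _ (expR (W 0%N `|complex.Re z|) * p (partial al f z))%:E).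
    rewrite lee_fin ler_peMl ?seminorm_ge0// -expR0 ler_expR.
    by have [h _ _] := hW.1 0%N; exact: h.
  by apply: ereal_sup_ubound; exists z.
case: S S_oo le_S => [r||] // _ hr.
  exists `|r| => // z /hr; rewrite lee_fin => /le_trans; apply; exact: ler_norm.
by exists 0 => // z /hr; rewrite leeNy_eq.
Qed.

End KWBounds.

(** * The local decomposition *)

Section PhaseTaylor.
Variable R : realType.
Implicit Types (mu c t : R) (X z u : Cplane R).

Definition phase_slope mu c X z : Cplane R := mu%:C * ('i%C - (2 * c)%:C * (z - X)).

Lemma is_rderive_phase mu c X u z :
  is_rderive u (fun w => cexp (phase mu c X w)) z
    (u * phase_slope mu c X z * cexp (phase mu c X z)).
Proof.
have quad t : phase mu c X (z + t%:C * u) =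
    phase mu c X z + t%:C * (u * phase_slope mu c X z) + (t ^+ 2)%:C * (- mu%:C * c%:C * u ^+ 2).
  rewrite /phase_slope /phase [(2 * c)%:C]rmorphM [(t ^+ 2)%:C]rmorphXn /=.
  by rewrite (rmorph_nat (real_complex R) 2); ring.
exact: (is_rderive_cexp quad).
Qed.

(** The modulus is a continuous seminorm on the plane, so [seminorm_taylor] applies to the
    exponential of the phase. Its second derivative is (phase'' + phase'^2) times itself, with
    |phase''| = 2 mu c and |phase'| <= mu (1 + 2 c Z). *)
Lemma phase_taylor mu c X u z t (Z M : R) : 0 <= mu -> 0 <= c -> normc (u : R[i]) = 1 ->
  0 <= t -> 0 <= M ->
  (forall s, 0 <= s <= t -> normc (z + s%:C * u - X : R[i]) <= Z /\
     normc (cexp (phase mu c X (z + s%:C * u)) : R[i]) <= M) ->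
  normc (cexp (phase mu c X (z + t%:C * u)) - cexp (phase mu c X z)
    - t%:C * (u * phase_slope mu c X z * cexp (phase mu c X z)) : R[i]) <=
  (2 * mu * c + (mu * (1 + 2 * c * Z)) ^+ 2) * M * t ^+ 2.
Proof.
move=> mu0 c0 u1 t0 M0 ZM.
have sn : @seminorm R (Cplane R) (fun z => normc (z : R[i])).
  by split=> [x y|a x]; [exact: ler_normcD|exact: normcM].
pose e w := cexp (phase mu c X w); pose L w := phase_slope mu c X w.
have dL w : is_rderive u (fun w => u * L w) w (u * (mu%:C * (- (2 * c)%:C * u))).
  have d0 (k w0 : Cplane R) (a : Cplane R -> Cplane R) l : is_rderive u a w0 l ->
      is_rderive u (fun w => k * a w) w0 (k * l).
    move=> da; have := is_rderive_mul (is_rderive_cst u k w0) da.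
    by rewrite mul0r add0r.
  apply: (d0 u); rewrite /L /phase_slope; apply: (d0 mu%:C).
  have := is_rderiveD (is_rderive_cst u ('i%C : Cplane R) w)
    (d0 (- (2 * c)%:C) w _ _ (@is_rderive_affine R X u w)).
  rewrite add0r; congr (is_rderive _ _ _ _).
  by apply/funext => w'; rewrite mulNr.
pose k w := u * (mu%:C * (- (2 * c)%:C * u)) * e w + u * L w * (u * L w * e w).
have dk w : is_rderive u (fun w => u * L w * e w) w (k w).
  exact: (@is_rderive_mul R _ _ u w _ _ (dL w) (@is_rderive_phase mu c X u w)).
apply: (@seminorm_taylor R (Cplane R) _ sn (@normc_continuous R) e (fun w => u * L w * e w) k z u t _ t0).
- by move=> s _; exact: is_rderive_phase.
- by move=> s _; exact: dk.
move=> s st; have [zZ eM] := ZM s st; set w := z + s%:C * u in zZ eM *.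
have Lb : normc (L w : R[i]) <= mu * (1 + 2 * c * Z).
  rewrite /L /phase_slope normcM normc_real (ger0_norm mu0) ler_wpM2l//.
  apply: le_trans (ler_normcD _ _) _; rewrite normci normc_opp normcM normc_real.
  by rewrite lerD2l ger0_norm ?mulr_ge0// ler_wpM2l// mulr_ge0.
have {}eM : normc (e w : R[i]) <= M by [].
rewrite /k; move: (L w) Lb (e w) eM => Lw Lb ew eM.
apply: le_trans (ler_normcD _ _) _; rewrite [leRHS]mulrDl; apply: lerD.
  rewrite !normcM u1 normc_opp !normc_real mul1r mulr1 (ger0_norm mu0) ger0_norm ?mulr_ge0//.
  have -> : 2 * mu * c * M = mu * (2 * c) * M by ring.
  by rewrite ler_wpM2l// !mulr_ge0.
rewrite !normcM u1 !mul1r mulrA expr2; apply: ler_pM; rewrite ?mulr_ge0 ?normc_ge0//.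
by apply: ler_pM; rewrite ?normc_ge0.
Qed.

End PhaseTaylor.

(** * Bumps and the choice of constants *)

Section Bell.
Variable R : realType.
Implicit Types (lam m t : R).

Definition bell lam m t : R := flat 0 (lam * (t - m) + 1) * flat 0 (1 - lam * (t - m)).

Lemma bell_ge0 lam m t : 0 <= bell lam m t.
Proof. by rewrite mulr_ge0// flat_ge0. Qed.

Lemma bell_eq0 lam m t : 0 < lam -> lam^-1 < `|t - m| -> bell lam m t = 0.
Proof.
move=> l0; rewrite -(ltr_pM2l l0) mulfV ?gt_eqF// -{1}(ger0_norm (ltW l0)) -normrM.
rewrite lter_normr /bell => /orP[h|h].
  by rewrite [X in _ * X]flat_eq0 ?mulr0//; lra.
by rewrite flat_eq0 ?mul0r//; lra.
Qed.

Lemma flat0_ge t : 2^-1 <= t -> expR (- 2) <= flat 0 t.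
Proof.
move=> t2; have t0 : 0 < t by apply: lt_le_trans t2; rewrite invr_gt0.
rewrite /flat t0 expr0 mul1r ler_expR lerN2 -[2]invrK.
by rewrite lef_pV2 ?posrE// invr_gt0.
Qed.

Lemma bell_ge lam m t : 0 < lam -> `|t - m| <= (2 * lam)^-1 -> expR (- 4) <= bell lam m t.
Proof.
move=> l0; rewrite -(ler_pM2l l0) -{1}(ger0_norm (ltW l0)) -normrM.
have -> : lam * (2 * lam)^-1 = 2^-1 by rewrite invfM mulrCA divff ?mulr1// gt_eqF.
rewrite ler_norml => /andP[h1 h2].
have -> : - 4 = - 2 + - 2 :> R by lra.
by rewrite expRD; apply: ler_pM; rewrite ?expR_ge0//; apply: flat0_ge; lra.
Qed.

Lemma normc_cexp_phase mu c (X : R) (z : Cplane R) :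
  normc (cexp (phase mu c X%:C z) : R[i]) =
  expR (mu * (- (complex.Im z - c * complex.Im z ^+ 2) - c * (complex.Re z - X) ^+ 2)).
Proof.
rewrite normc_cexp; congr expR; case: z => x y.
by rewrite /phase expr2 /=; ring.
Qed.

Lemma cexp_phaseN mu c (X z : Cplane R) :
  cexp (phase mu c X z) * cexp (phase (- mu) c X z) = 1.
Proof. by rewrite [phase (- mu) c X z](_ : _ = - phase mu c X z) ?cexpN// /phase rmorphN mulNr. Qed.

Lemma large_parameter (e V d : R) : 0 < e -> 0 < d -> exists L, forall lam, L <= lam ->
  [/\ 4 <= lam, lam^-1 <= e / 2, lam^-1 < d & 2 * Num.sqrt lam + V <= lam * e / 4].
Proof.
(* In the last estimate each summand receives lam e / 8: the square gives sqrt lam >= 16 / e, and 8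
   |V| / e takes care of [V]. *)
move=> e0 d0; exists (4 + 2 / e + 2 / d + (16 / e) ^+ 2 + 8 * `|V| / e) => lam Ll.
have p1 : 0 < 2 / e by rewrite divr_gt0.
have p2 : 0 < 2 / d by rewrite divr_gt0.
have p3 : 0 < (16 / e) ^+ 2 by rewrite exprn_gt0// divr_gt0.
have p4 : 0 <= 8 * `|V| / e by rewrite divr_ge0 ?mulr_ge0// ltW.
have l0 : 0 < lam by lra.
split; first lra.
- by rewrite -[e / 2]invf_div lef_pV2 ?posrE//; lra.
- rewrite -[d]invrK ltf_pV2 ?posrE ?invr_gt0//.
  have : 0 < d^-1 by rewrite invr_gt0.
  by lra.
- have h1 : 2 * Num.sqrt lam <= lam * e / 8.
    have s16 : 16 / e <= Num.sqrt lam.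
      by rewrite -(ger0_norm (ltW (divr_gt0 (ltr0n _ 16) e0))) -sqrtr_sqr ler_wsqrtr//; lra.
    rewrite ler_pdivrMr// in s16.
    rewrite -[in leRHS](sqr_sqrtr (ltW l0)) expr2.
    have := ler_wpM2l (sqrtr_ge0 lam) s16; lra.
  have h2 : V <= lam * e / 8.
    have : 8 * `|V| / e <= lam by lra.
    rewrite ler_pdivrMr//; have := ler_norm V; lra.
  lra.
Qed.

Lemma large_divisor (a b a' b' : R) : 0 < b -> 0 < b' ->
  exists q : nat, [/\ (0 < q)%N, a / q%:R <= b & a' / q%:R <= b'].
Proof.
move=> b0 b'0; exists (Num.truncn (`|a / b| + `|a' / b'|)).+1.
have := ltW (truncnS_gt (`|a / b| + `|a' / b'|)).
set q := _.+1%:R => hq; have q0 : 0 < q by rewrite ltr0n.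
split=> //; rewrite ler_pdivrMr// mulrC -ler_pdivrMr//; apply: le_trans hq.
  by apply: le_trans (ler_norm _) _; rewrite lerDl.
by apply: le_trans (ler_norm _) _; rewrite lerDr.
Qed.

(** The slope 1 - 2 c y of the parabola is at least 1/2 up to y = l. *)
Lemma parabola_le (l c y y' : R) : 0 < l -> c = (4 * l)^-1 -> y <= y' -> y' <= l ->
  y - c * y ^+ 2 + (y' - y) / 2 <= y' - c * y' ^+ 2.
Proof.
move=> l0 cE yy yl; have c0 : 0 < c by rewrite cE invr_gt0 mulr_gt0.
have cl : c * l = 4^-1 by rewrite cE; field; rewrite gt_eqF.
have : 0 <= (y' - y) * (2^-1 - c * (y + y')).
  have cll : c * (l + l) = 2^-1 by rewrite mulrDr cl; lra.
  by rewrite mulr_ge0 ?subr_ge0// -cll ler_pM2l//; lra.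
by lra.
Qed.

(** Here 6 l + 1 is an upper bound for the length of the top and vertical sides, plus 1 for the grid
    error; the second factor on the right is a lower bound for the coefficient of [x]. The left
    factor exceeds 1 / [amp] by e^(lam e / 4), which has to beat [Wi], two square roots (one from
    the damping, one from lam^2 <= 24 e^(sqrt lam)), the e^-8 of the bells and the constant 48 (6 l
    + 1). *)
Lemma amplitude_bound (l lam Wi A0 e : R) : 0 < l -> 4 <= lam ->
  2 * Num.sqrt lam + (Wi + 8 + 48 * (6 * l + 1)) <= lam * e / 4 ->
  (6 * l + 1) <= expR (lam * (A0 + e / 4)) *
    (2 * (expR (- 4) * (2 * lam)^-1) ^+ 2 * expR (- (lam * A0)) *
       expR (- (Num.sqrt lam + Wi))).
Proof.
move=> l0 lam4 h; have lam0 : 0 < lam by lra.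
have l2 : lam ^+ 2 <= 24 * expR (Num.sqrt lam).
  have := @expR_ge_Xn R 4 (Num.sqrt lam) (sqrtr_ge0 _).
  by rewrite (_ : 4 = 2 * 2)%N// exprM sqr_sqrtr// ltW.
have -> : expR (lam * (A0 + e / 4)) *
    (2 * (expR (- 4) * (2 * lam)^-1) ^+ 2 * expR (- (lam * A0)) *
       expR (- (Num.sqrt lam + Wi))) =
    expR (lam * e / 4 - 8 - Num.sqrt lam - Wi) / (2 * lam ^+ 2).
  have -> : lam * e / 4 - 8 - Num.sqrt lam - Wi =
      lam * (A0 + e / 4) + (- 4 + - 4) + - (lam * A0) + - (Num.sqrt lam + Wi) by lra.
  by rewrite !expRD; field; rewrite gt_eqF.
rewrite ler_pdivlMr ?mulr_gt0 ?exprn_gt0//.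
apply: (@le_trans _ _ (expR (Num.sqrt lam + 48 * (6 * l + 1)))); last first.
  by rewrite ler_expR; lra.
rewrite expRD mulrC; have h1 : 48 * (6 * l + 1) <= expR (48 * (6 * l + 1)).
  by apply: le_trans (expR_ge1Dx _); rewrite lerDr.
apply: (@le_trans _ _ (expR (Num.sqrt lam) * (48 * (6 * l + 1)))); last first.
  by rewrite ler_wpM2l// expR_ge0.
have : (6 * l + 1) * lam ^+ 2 <= (6 * l + 1) * (24 * expR (Num.sqrt lam)).
  by rewrite ler_wpM2l//; lra.
by lra.
Qed.

End Bell.

Section LocalSplit.
Variables (R : realType) (E : tvsType R[i]) (BN BK : set E).
Hypotheses (cBN : absolutely_convex BN) (cBK : absolutely_convex BK).
Variables (l e lam X Wi : R) (x : E).
Let c := (4 * l)^-1.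
Let par (y : R) := y - c * y ^+ 2.
(* On the support of [box_fun], [Im z <= l - 4 e] and the real quadratic term is
   at most [e / 4], so [exp (- lam A0)] makes [box_fun] bounded by 1; yet [A0]
   is [e / 2] below the exponent [par (l - 2 e)] of the upper side. *)
Let A0 := par (l - 4 * e) + e / 4.
Let Y := l - 9 / 2 * e.

(** The factor with [- lam] is the reciprocal of the exponential [h] used in Green's formula. Thus
    [h] times [box_fun] is real and nonnegative, and nothing cancels in the grid sum. *)
Definition box_fun (z : Cplane R) : Cplane R :=
  (bell lam X (complex.Re z) * bell lam Y (complex.Im z))%:C *
  ((expR (- (lam * A0)))%:C * cexp (phase (- lam) c X%:C z)).

Let D := rect (X - 2 * l) (4 * l) (l - 2 * e).
Variables (f fx fy : Cplane R -> E).
Hypothesis fBK : forall z, D z -> [/\ BK (f z), BK (fx z) & BK (fy z)].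
Hypothesis fBN : forall z, D z -> complex.Im z = 0 -> BN (f z).
Hypotheses (fxT : taylor2 BK (X - 2 * l) (4 * l) (l - 2 * e) f 1 fx).
Hypotheses (fyT : taylor2 BK (X - 2 * l) (4 * l) (l - 2 * e) f 'i%C fy).
Hypothesis feq : forall z, D z ->
  fx z + 'i%C *: fy z = (2 * box_fun z : R[i]) *: ((expR (- (Num.sqrt lam + Wi)))%:C *: x).

Lemma local_split : 0 < l -> 0 < e -> e <= l / 16 -> 4 <= lam -> lam^-1 <= e / 2 ->
  2 * Num.sqrt lam + (Wi + 8 + 48 * (6 * l + 1)) <= lam * e / 4 -> exists yn yk, [/\ x = yn + yk,
  scaled (expR (lam * l)) BN yn & scaled (expR (- (lam * e / 4))) BK yk].
Proof.
move=> l0 e0 el lam4 lame lamV; have lam0 : 0 < lam by lra.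
have c0 : 0 < c by rewrite invr_gt0 mulr_gt0.
have cl : c * l = 4^-1 by rewrite /c; field; rewrite gt_eqF.
pose h (z : Cplane R) := cexp (phase lam c X%:C z).
pose h' (z : Cplane R) := phase_slope lam c X%:C z * h z.
pose amp := expR (- (lam * A0)); pose del := expR (- (Num.sqrt lam + Wi)).
pose rho (z : Cplane R) := bell lam X (complex.Re z) * bell lam Y (complex.Im z).
pose v := (2 * amp * del)%:C *: x.
pose A1 := par (l - 2 * e); pose M1 := expR (- (lam * A1)).
have par0 y : 0 <= y -> y <= l -> 0 <= par y.
  move=> y0 yl; have := @parabola_le R l c 0 y l0 erefl y0 yl; rewrite /par; lra.
have A1l : A1 <= l.
  have : 0 <= c * (l - 2 * e) ^+ 2 by rewrite mulr_ge0 ?sqr_ge0// ltW.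
  by rewrite /A1 /par; lra.
have A01 : A0 + e / 2 <= A1.
  have := @parabola_le R l c (l - 4 * e) (l - 2 * e) l0 erefl ltac:(lra) ltac:(lra).
  by rewrite /A0 /A1 /par; lra.
have A0l : A0 + e / 4 <= l by lra.
have l1p : 0 < 4 * l by lra.
have l2p : 0 < l - 2 * e by lra.
have Dy z : D z -> 0 <= complex.Im z <= l by move=> [_ /andP[? ?]]; apply/andP; split; lra.
have hN z : normc (h z : R[i]) = expR (lam * (- par (complex.Im z) - c * (complex.Re z - X) ^+ 2)).
  by rewrite /h normc_cexp_phase.
have h1 z : D z -> normc (h z : R[i]) <= 1.
  move=> Dz; have /andP[y0 yl] := Dy z Dz; rewrite hN -expR0 ler_expR.
  rewrite pmulr_rle0//; have := par0 _ y0 yl.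
  have : 0 <= c * (complex.Re z - X) ^+ 2 by rewrite mulr_ge0 ?sqr_ge0// ltW.
  by lra.
pose Z := 3 * l.
have DZ z : D z -> normc (z - X%:C : R[i]) <= Z.
  move=> Dz; have /andP[y0 yl] := Dy z Dz; case: Dz => /andP[x1 x2] _.
  apply: le_trans (ler_normc_ReIm _) _.
  have -> : complex.Re (z - X%:C) = complex.Re z - X by case: (z).
  have -> : complex.Im (z - X%:C) = complex.Im z by case: (z) => ? ? /=; rewrite subr0.
  have : `|complex.Re z - X| <= 2 * l by rewrite ler_norml; apply/andP; split; lra.
  by rewrite (ger0_norm y0) /Z; lra.
pose S1 := lam * (1 + 2 * c * Z).
have S10 : 0 <= S1 by rewrite mulr_ge0 ?(ltW lam0)// addr_ge0// !mulr_ge0// ltW.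
(* The summands bound |h|, |h'| and the second-order remainder, in this order. The size of [Ch] is
   irrelevant, because [q] is chosen afterwards. *)
pose Ch := 1 + S1 + (2 * lam * c + S1 ^+ 2).
have lc0 : 0 <= 2 * lam * c by rewrite !mulr_ge0// ltW.
have S12 : 0 <= S1 ^+ 2 by rewrite exprn_ge0.
have hC z : D z -> normc (h z : R[i]) <= Ch /\ normc (h' z : R[i]) <= Ch.
  move=> Dz; have hz := h1 z Dz; split; first by rewrite /Ch; lra.
  rewrite /h' normcM; apply: (@le_trans _ _ (S1 * 1)); last by rewrite /Ch; lra.
  apply: ler_pM; rewrite ?normc_ge0//.
  rewrite /phase_slope normcM normc_real (ger0_norm (ltW lam0)) ler_wpM2l ?(ltW lam0)//.
  apply: le_trans (ler_normcD _ _) _; rewrite normci normc_opp normcM normc_real lerD2l.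
  have c2 : 0 <= 2 * c by rewrite mulr_ge0// ltW.
  by rewrite (ger0_norm c2) ler_wpM2l// DZ.
have Dcvx (u z : Cplane R) t s : (u = 1 \/ u = 'i%C) -> D z -> D (z + t%:C * u) ->
    0 <= s <= t -> D (z + s%:C * u).
  move=> u1 Dz Dzt /andP[s0 st]; move: Dz Dzt.
  case: z => z1 z2 [/= /andP[a1 a2] /andP[a3 a4]] [/= /andP[b1 b2] /andP[b3 b4]].
  case: u1 b1 b2 b3 b4 => -> /=; rewrite !mulr0 !mul0r !mulr1 ?subr0 ?addr0 ?add0r.
    by move=> b1 b2 b3 b4; split; apply/andP => /=; split; lra.
  by move=> b1 b2 b3 b4; split; apply/andP => /=; split; lra.
have hT (u : Cplane R) z t : normc (u : R[i]) = 1 -> (u = 1 \/ u = 'i%C) ->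
    D z -> 0 < t -> D (z + t%:C * u) ->
    normc (h (z + t%:C * u) - h z - t%:C * (u * h' z) : R[i]) <= Ch * t ^+ 2.
  move=> nu u1 Dz t0 Dzt.
  apply: (@le_trans _ _ ((2 * lam * c + S1 ^+ 2) * 1 * t ^+ 2)); last first.
    by rewrite ler_wpM2r ?exprn_ge0 ?(ltW t0)// /Ch; lra.
  rewrite /h' mulrA; apply: phase_taylor => //; rewrite ?(ltW t0) ?(ltW c0) ?(ltW lam0)//.
  by move=> s st; have Ds := Dcvx u z t s u1 Dz Dzt st; split; [exact: DZ|exact: h1].
have heq z : D z -> (h z : R[i]) *: (fx z + 'i%C *: fy z) = (rho z)%:C *: v.
  move=> Dz; rewrite feq// !scalerA; congr (_ *: _).
  have := cexp_phaseN lam c X%:C z; rewrite -/(h z) /box_fun -/amp -/del -/(rho z) => hh.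
  set g := cexp _ in hh *.
  have -> : h z * (2 * ((rho z)%:C * (amp%:C * g))) * del%:C =
      (h z * g) * ((rho z)%:C * (2 * amp%:C * del%:C)) by ring.
  have -> : (2 * amp * del)%:C = 2 * amp%:C * del%:C :> R[i].
    rewrite [LHS]rmorphM; congr (_ * _).
    by rewrite [LHS]rmorphM; congr (_ * _); exact: (rmorph_nat (real_complex R) 2).
  by rewrite hh mul1r.
have hbot z : D z -> complex.Im z = 0 -> normc (h z : R[i]) <= 1 by move=> Dz _; exact: h1.
have hside z : D z -> complex.Im z = l - 2 * e \/ complex.Re z = X - 2 * l \/
    complex.Re z = X - 2 * l + 4 * l -> normc (h z : R[i]) <= M1.
  move=> Dz; have /andP[y0 yl] := Dy z Dz; have p0 := par0 _ y0 yl.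
  have q0 : 0 <= c * (complex.Re z - X) ^+ 2 by rewrite mulr_ge0 ?sqr_ge0// ltW.
  move=> zc; rewrite hN /M1 ler_expR -[leRHS]mulrN ler_pM2l//; case: zc => [yE|xE].
    by rewrite yE in p0 *; rewrite -/A1; lra.
  (* On the vertical sides, at distance 2 l from [X], the quadratic term alone contributes l, which
     is at least [A1]. *)
  have -> : c * (complex.Re z - X) ^+ 2 = l.
    have -> : (complex.Re z - X) ^+ 2 = 4 * l * l by case: xE => ->; ring.
    by rewrite mulrA [c * _]mulrCA cl; lra.
  lra.
pose C4 := 4 * l * (l - 2 * e) * (4 * l + (l - 2 * e)) * (Ch * (3 + 4 * l + (l - 2 * e))).
have C40 : 0 <= C4.
  have Ch0 : 0 <= Ch by rewrite /Ch; lra.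
  have w1 : 0 <= 4 * l by lra.
  have w2 : 0 <= l - 2 * e by lra.
  have w3 : 0 <= 4 * l + (l - 2 * e) by lra.
  have w4 : 0 <= 3 + 4 * l + (l - 2 * e) by lra.
  exact: mulr_ge0 (mulr_ge0 (mulr_ge0 w1 w2) w3) (mulr_ge0 Ch0 w4).
(* The mesh must resolve the plateau of the bells, and the grid error must not exceed the bound [M1]
   on the three sides. *)
have [q [q0 qlam qM]] : exists q : nat, [/\ (0 < q)%N, 4 * l / q%:R <= (2 * lam)^-1 &
    C4 / q%:R <= M1].
  by apply: large_divisor; rewrite ?invr_gt0 ?mulr_gt0 ?expR_gt0.
have [yN [yK [vE yNB yKB]]] := grid_green cBN cBK l1p l2p fBK fBN fxT fyT hC hT heq
  (expR_ge0 _) hbot hside q0.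
move: vE; set Sq := (X in X%:C *: v) => vE.
pose sig := (expR (- 4) * (2 * lam)^-1) ^+ 2.
have qp : 0 < q%:R :> R by rewrite ltr0n.
have lam20 : 0 < (2 * lam)^-1 by rewrite invr_gt0 mulr_gt0.
have lam2e : (2 * lam)^-1 <= e / 4 by rewrite invfM; lra.
have qK (t : R) : q%:R * (t / q%:R) = t by rewrite mulrC divfK// gt_eqF.
have Sqsig : sig <= Sq.
  pose b1 t := bell lam X t; pose b2 t := bell lam Y t.
  have -> : Sq = (4 * l / q%:R * \sum_(0 <= a < q) b1 (X - 2 * l + a%:R * (4 * l / q%:R))) *
     ((l - 2 * e) / q%:R * \sum_(0 <= b < q) b2 (0 + b%:R * ((l - 2 * e) / q%:R))).
    rewrite [RHS]mulrACA; congr (_ * _).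
    by rewrite big_distrl; apply: eq_bigr => a _; rewrite big_distrr.
  have ec : 0 < expR (- 4) :> R by exact: expR_gt0.
  rewrite /sig expr2; apply: ler_pM; rewrite ?mulr_ge0 ?expR_ge0 ?(ltW lam20)//.
    apply: (@riemann_sum_ge R b1 _ _ X) => //.
    - by move=> t; exact: bell_ge0.
    - by move=> t; exact: bell_ge.
    - by rewrite divr_gt0.
    - lra.
    - by rewrite qK; lra.
  apply: (@riemann_sum_ge R b2 _ _ Y) => //.
  - by move=> t; exact: bell_ge0.
  - by move=> t; exact: bell_ge.
  - by rewrite divr_gt0.
  - by apply: le_trans qlam; rewrite ler_pM2r ?invr_gt0//; lra.
  - by rewrite /Y; lra.
  - by rewrite add0r qK /Y; lra.
(* The exact coefficient [Dn] of [x] depends on the grid; [T] is a lower bound for it that does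
   not. *)
pose T := 2 * sig * amp * del.
have amp0 : 0 < amp := expR_gt0 _; have del0 : 0 < del := expR_gt0 _.
have sig0 : 0 < sig by rewrite exprn_gt0// mulr_gt0 ?expR_gt0.
have T0 : 0 < T by rewrite !mulr_gt0.
pose Dn := Sq * (2 * amp * del).
have DnT : T <= Dn.
  have -> : T = sig * (2 * amp * del) by rewrite /T; ring.
  by rewrite ler_pM2r// !mulr_gt0.
have Dn0 : 0 < Dn := lt_le_trans T0 DnT.
have TB : 6 * l + 1 <= expR (lam * (A0 + e / 4)) * T by exact: amplitude_bound.
have scl (B : set E) a b y : absolutely_convex B -> 0 <= a -> 0 <= b -> a <= b * T ->
    scaled a B y -> scaled b B ((Dn^-1)%:C *: y).
  move=> cB a0 b0 ab By; apply: scaledZ By => //.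
  rewrite normc_real ger0_norm ?invr_ge0 ?(ltW Dn0)// ler_pdivrMl//.
  by apply: le_trans ab _; rewrite mulrC ler_wpM2r.
exists ((Dn^-1)%:C *: yN), ((Dn^-1)%:C *: yK); split.
- rewrite -scalerDr -vE /v !scalerA -!rmorphM.
  by rewrite (_ : Dn^-1 * (Sq * (2 * amp * del)) = 1) ?scale1r// mulVf// gt_eqF.
- apply: scl yNB; rewrite ?expR_ge0 ?(ltW l1p)//.
  apply: (@le_trans _ _ (6 * l + 1)); first lra.
  apply: le_trans TB _; rewrite ler_pM2r// ler_expR ler_pM2l//; lra.
- apply: scl yKB => //; rewrite ?expR_ge0//.
    apply: addr_ge0; last exact: divr_ge0 C40 (ltW qp).
    by apply: mulr_ge0; [lra|exact: expR_ge0].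
  rewrite -/C4.
  apply: (@le_trans _ _ ((6 * l + 1) * M1)).
    have gen (m C5 : R) : 0 <= m -> C5 <= m ->
        (4 * l + 2 * (l - 2 * e)) * m + C5 <= (6 * l + 1) * m.
      by move=> m0 C5m; have := mulr_ge0 (ltW e0) m0; lra.
    exact: gen (expR_ge0 _) qM.
  have M10 : 0 < M1 := expR_gt0 _.
  rewrite mulrC -ler_pdivlMl//; apply: le_trans TB _.
  rewrite [leRHS]mulrA ler_pM2r// /M1 -expRN opprK -expRD ler_expR.
  by have := ler_wpM2l (ltW lam0) A01; lra.
Qed.

End LocalSplit.

Section BoxFamily.
Variables (R : realType) (l : R) (e lam X : nat -> R).

Definition box i : set (Cplane R) :=
  [set z | `|complex.Re z - X i| <= (lam i)^-1 /\
           `|complex.Im z - (l - 9 / 2 * e i)| <= (lam i)^-1].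

Definition box_family i : Cplane R -> Cplane R := box_fun l (e i) (lam i) (X i).

Lemma closed_box i : closed (box i).
Proof.
have cl (x : Cplane R -> R) (m r : R) : continuous x -> closed [set z | `|x z - m| <= r].
  move=> cx; have -> : [set z | `|x z - m| <= r] =
      x @^-1` [set t | t <= m + r] `&` x @^-1` [set t | m - r <= t].
    apply/seteqP; split=> z /=; rewrite ler_norml.
      by move=> /andP[h1 h2]; split; lra.
    by move=> [h1 h2]; apply/andP; split; lra.
  apply: closedI; apply: closed_comp; try (by move=> w _; exact: cx).
    exact: closed_le.
  exact: closed_ge.
exact: closedI (cl _ _ _ (@Re_continuous R)) (cl _ _ _ (@Im_continuous R)).
Qed.

Lemma box_Im i z : (lam i)^-1 <= e i / 2 -> box i z ->
  l - 5 * e i <= complex.Im z <= l - 4 * e i.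
Proof. by move=> le [_]; rewrite ler_norml => /andP[h1 h2]; apply/andP; split; lra. Qed.

Lemma box_supported : (forall i, 4 <= lam i) -> supported box box_family.
Proof.
move=> lam4 i z nS; have l0 : 0 < lam i by apply: lt_le_trans (lam4 i).
rewrite /box_family /box_fun.
have [h|h] := leP `|complex.Re z - X i| (lam i)^-1; last first.
  by rewrite bell_eq0// !mul0r.
have [h'|h'] := leP `|complex.Im z - (l - 9 / 2 * e i)| (lam i)^-1; last first.
  by rewrite (@bell_eq0 _ _ (l - 9 / 2 * e i))// mulr0 mul0r.
by case: nS.
Qed.

Hypothesis l0 : 0 < l.

Lemma box_smooth k : (forall i, 0 < e i) -> (forall i, e i <= l / 16) ->
  (forall i, 4 <= lam i) -> (forall i, (lam i)^-1 <= e i / 2) ->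
  smooth_family box lam k box_family.
Proof.
move=> e0 el lam4 lame; have l0' := l0.
have lam1 i : 1 <= lam i by apply: le_trans (lam4 i); lra.
have lam0 i : 0 < lam i by apply: lt_le_trans (lam1 i).
set c := (4 * l)^-1.
have c0 : 0 < c by rewrite invr_gt0 mulr_gt0.
pose amp i := expR (- (lam i * ((l - 4 * e i) - c * (l - 4 * e i) ^+ 2 + e i / 4))).
pose nlam i := - lam i.
have nl i : `|lam i| <= lam i by rewrite ger0_norm// ltW.
have nl' i : `|nlam i| <= lam i by rewrite normrN.
have n0 i : `|(fun=> 0 : R) i : R| <= lam i by rewrite normr0 ltW.
pose Y i := l - 9 / 2 * e i.
(* Each of the two bells is a product of two flat functions of affine arguments, which gives four
   factors besides the exponential. *)
pose v1 i (z : Cplane R) : Cplane R := (flat 0 (lam i * complex.Re z + 0 * complex.Im z + (1 - lam i * X i)))%:C.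
pose v2 i (z : Cplane R) : Cplane R := (flat 0 (nlam i * complex.Re z + 0 * complex.Im z + (1 + lam i * X i)))%:C.
pose v3 i (z : Cplane R) : Cplane R := (flat 0 (0 * complex.Re z + lam i * complex.Im z + (1 - lam i * Y i)))%:C.
pose v4 i (z : Cplane R) : Cplane R := (flat 0 (0 * complex.Re z + nlam i * complex.Im z + (1 + lam i * Y i)))%:C.
pose w i (z : Cplane R) : Cplane R := (amp i)%:C * cexp (phase (nlam i) c (X i)%:C z).
have -> : box_family = (fun i z => v1 i z * v2 i z * (v3 i z * v4 i z) * w i z).
  apply/funext => i; apply/funext => z; rewrite /box_family /box_fun -/c /w.
  congr (_ * _); rewrite /v1 /v2 /v3 /v4 [LHS]rmorphM /bell [X in X * _]rmorphM [X in _ * X]rmorphM.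
  by congr (_%:C * _%:C * (_%:C * _%:C)); congr (flat 0 _); rewrite /nlam /Y; ring.
apply: (smooth_familyM lam1); [apply: (smooth_familyM lam1); apply: (smooth_familyM lam1)|].
- exact: (@smooth_family_flat R box lam lam1 k 0 lam (fun=> 0) (fun i => 1 - lam i * X i) nl n0).
- exact: (@smooth_family_flat R box lam lam1 k 0 nlam (fun=> 0) (fun i => 1 + lam i * X i) nl' n0).
- exact: (@smooth_family_flat R box lam lam1 k 0 (fun=> 0) lam (fun i => 1 - lam i * Y i) n0 nl).
- exact: (@smooth_family_flat R box lam lam1 k 0 (fun=> 0) nlam (fun i => 1 + lam i * Y i) n0 nl').
apply: (@smooth_family_cexp R box lam lam1 k nlam amp c (l + 1) (fun i => (X i)%:C)).
- by rewrite addr_ge0// ltW.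
- move=> i; apply: le_trans (nl' i) _; rewrite ler_peMl ?(ltW (lam0 i))//; lra.
- move=> i z Sz; have [y1 y2] := andP (box_Im (lame i) Sz).
  apply: le_trans (ler_normc_ReIm _) _.
  have -> : complex.Re (z - (X i)%:C) = complex.Re z - X i by case: (z).
  have -> : complex.Im (z - (X i)%:C) = complex.Im z by case: (z) => ? ? /=; rewrite subr0.
  have ei := e0 i; have eli := el i; have li := lame i; case: Sz => xz _.
  have lam1' : (lam i)^-1 <= 1 by rewrite invf_le1.
  by rewrite [X in _ + X]ger0_norm; lra.
exists 1, 0%N; split=> // i z Sz; rewrite expr0 mulr1.
rewrite normcM normc_real ger0_norm ?expR_ge0// normc_cexp_phase -expRD.
apply: (@le_trans _ _ (expR 0)); last by rewrite expR0.
rewrite ler_expR.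
have [y1 y2] := andP (box_Im (lame i) Sz).
have ei := e0 i; have eli := el i; have li := lame i; case: Sz => xz _.
have p1 := @parabola_le R l c (complex.Im z) (l - 4 * e i) l0 erefl y2 ltac:(lra).
have cl : c * l = 4^-1 by rewrite /c; field; rewrite gt_eqF.
have p2 : c * (complex.Re z - X i) ^+ 2 <= e i / 4.
  have x2 : `|complex.Re z - X i| <= e i / 2 by lra.
  have sq : (complex.Re z - X i) ^+ 2 <= (e i / 2) ^+ 2.
    by rewrite -[leLHS]real_normK ?num_real// lerXn2r ?nnegrE//; lra.
  have h1 : c * (complex.Re z - X i) ^+ 2 <= c * (e i / 2) ^+ 2 by rewrite ler_wpM2l// ltW.
  have h2 : c * e i <= c * (l / 16) by rewrite ler_wpM2l// ltW.
  have h3 : c * e i <= 64^-1 by rewrite mulrA cl in h2; lra.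
  have h4 : c * e i * e i <= 64^-1 * e i by rewrite ler_wpM2r// ltW.
  lra.
have -> : - (lam i * (l - 4 * e i - c * (l - 4 * e i) ^+ 2 + e i / 4)) +
    nlam i * (- (complex.Im z - c * complex.Im z ^+ 2) - c * (complex.Re z - X i) ^+ 2) =
    - (lam i * ((l - 4 * e i - c * (l - 4 * e i) ^+ 2 + e i / 4) -
       (complex.Im z - c * complex.Im z ^+ 2) - c * (complex.Re z - X i) ^+ 2)).
  by rewrite /nlam; ring.
rewrite oppr_le0 mulr_ge0 ?(ltW (lam0 i))//; lra.
Qed.

End BoxFamily.

(** * Bounded sets of values of a solution *)

Section RegionBounded.
Variables (R : realType) (E : tvsType R[i]).
Hypothesis hE : hausdorff_space E.
Variables (W : nat -> R -> R) (F G : R -> R) (f : Cplane R -> E).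
Hypotheses (hW : weight_system W) (hf : KW W F G f).
Hypotheses (F0 : forall t, 0 <= F t) (G0 : forall t, 0 <= G t).
Variables (a : R) (Om : set (Cplane R)).
Hypotheses (a0 : 0 < a) (a1 : a < 1).
Hypothesis Oma : Om `<=` strip (fun t => a * F t) (fun t => a * G t).
Hypothesis Omcvx : forall (u z : Cplane R) (t s : R), u = 1 \/ u = 'i%C ->
  Om z -> Om (z + t%:C * u) -> 0 <= s <= t -> Om (z + s%:C * u).

(** Everything that Green's formula on the grid asks of [f] is gathered in one set, so that a single
    member of the fundamental sequence contains it. *)
Definition region_values : set E := [set y | exists2 z, Om z &
  [\/ y = f z, y = dx f z, y = dy f z | exists2 t : R, 0 < t &
    (Om (z + t%:C * 1) /\ y = (t ^- 2)%:C *: (f (z + t%:C * 1) - f z - t%:C *: dx f z)) \/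
    (Om (z + t%:C * 'i%C) /\ y = (t ^- 2)%:C *: (f (z + t%:C * 'i%C) - f z - t%:C *: dy f z))]].

Lemma region_strip z : Om z -> strip F G z.
Proof.
move=> /Oma /andP[h1 h2]; have h3 := F0 (complex.Re z); have h4 := G0 (complex.Re z).
have aF : a * F (complex.Re z) <= F (complex.Re z) by rewrite ler_piMl// ltW.
have aG : a * G (complex.Re z) <= G (complex.Re z) by rewrite ler_piMl// ltW.
by apply/andP; split; lra.
Qed.

(** By [tvs_bounded_seminorm] one seminorm is treated at a time. The remainders are bounded by pure
    second derivatives, because [Omcvx] keeps the horizontal and vertical segments inside [Om]. *)
Lemma region_bounded : tvs_bounded region_values.
Proof.
apply: tvs_bounded_seminorm => p sp cp.
have bnd al := KW_seminorm_bounded hW hf al sp cp a0 a1.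
have cl z : Om z -> closure (strip (fun t => a * F t)%R (fun t => a * G t)%R) z.
  by move=> /Oma; exact: subset_closure.
have [M0 M00 hM0] := bnd (0%N, 0%N); have [M1 M10 hM1] := bnd (1%N, 0%N).
have [M2 M20 hM2] := bnd (0%N, 1%N); have [M3 M30 hM3] := bnd (2%N, 0%N).
have [M4 M40 hM4] := bnd (0%N, 2%N).
have [_ [d0 [_ [d1 _ _]] [_ [d2 _ _]]]] := hf.1 2%N.
have taylor (u : Cplane R) (g k : Cplane R -> E) (M : R) z t : (u = 1 \/ u = 'i%C) ->
    0 <= M -> 0 < t -> Om z -> Om (z + t%:C * u) ->
    (forall w, Om w -> is_rderive u f w (g w)) ->
    (forall w, Om w -> is_rderive u g w (k w)) ->
    (forall w, Om w -> p (k w) <= M) ->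
    p ((t ^- 2)%:C *: (f (z + t%:C * u) - f z - t%:C *: g z)) <= M.
  move=> u1 M'0 t0 Oz Ozt df dg kM.
  rewrite seminormZ// ger0_norm ?invr_ge0 ?exprn_ge0 ?(ltW t0)//.
  rewrite ler_pdivrMl ?exprn_gt0// [leRHS]mulrC.
  have seg s : 0 <= s <= t -> Om (z + s%:C * u) by apply: (Omcvx u1 Oz Ozt).
  by apply: (seminorm_taylor sp cp (ltW t0)) => s st; [apply: df|apply: dg|apply: kM]; exact: seg.
exists (M0 + M1 + M2 + M3 + M4) => y [z Oz []].
- by move=> ->; have := hM0 z (cl z Oz); rewrite /partial /=; lra.
- by move=> ->; have := hM1 z (cl z Oz); rewrite /partial /=; lra.
- by move=> ->; have := hM2 z (cl z Oz); rewrite /partial /=; lra.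
- move=> [t t0 [[Ozt ->]|[Ozt ->]]].
    apply: (@le_trans _ _ M3); last lra.
    apply: (taylor 1 (dx f) (dx (dx f))) => //; first by left.
    + by move=> w /region_strip /d0[h _]; exact: rderivableP.
    + by move=> w /region_strip /d1[h _]; exact: rderivableP.
    + by move=> w /cl /hM3.
  apply: (@le_trans _ _ M4); last lra.
  apply: (taylor 'i%C (dy f) (dy (dy f))) => //; first by right.
  + by move=> w /region_strip /d0[_ h]; exact: rderivableP.
  + by move=> w /region_strip /d2[_ h]; exact: rderivableP.
  + by move=> w /cl /hM4.
Qed.

End RegionBounded.

(** * The contradiction *)

Theorem theorem3p11 (R : realType) (F G : R -> R) (W : nat -> R -> R)
    (E : tvsType R[i]) (B : nat -> set E)
    (hF : calF F) (hG : calF G) (hW : weight_system W)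
    (hE : hausdorff_space E) (hlc : locally_complete E)
    (hB : fundamental_bounded_sequence B)
    (hsurj : dbar_surjective E W F G) :
  condition_A B.
Proof.
apply: contrapT => nA.
have [FI [FS [FI0 FB]]] := calF_bounds hF.
have [GI [GS [GI0 GB]]] := calF_bounds hG.
have F0 t : 0 <= F t by apply: le_trans (ltW FI0) _; case/andP: (FB t).
have G0 t : 0 < G t by apply: lt_le_trans GI0 _; case/andP: (GB t).
have cF := calF_continuous hF.
have [l [l0 l_lb l_ub]] := liminf_exists FI0 FB.
pose ee (n : nat) : R := l / (16 * n.+1%:R).
have ee0 n : 0 < ee n by rewrite divr_gt0// mulr_gt0// ltr0n.
have eel n : ee n <= l / 16.
  by rewrite ler_pM2l// lef_pV2 ?posrE// ?ler_peMr ?mulr_gt0 ?ler1n// ltr0n.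
have [xs xsP] := choice (fun n => l_lb (ee n) (ee0 n)).
have [mm mmP] := choice (fun n => not_condition_A hB nA n (divr_gt0 (ee0 n) (mulr_gt0 (ltr0n R 4) l0))).
have H n : exists d : R, 0 < d /\ forall x y, `|x - y| < d -> `|F x - F y| < ee n.
  by have [d d0 dP] := calF_unif hF (ee0 n); exists d.
have [du duP] := choice H; clear H.
(* The margin 2 l is the half-width of the rectangle, which thus stays where F > l - e. The
   separation 4 l + 4 keeps every other box away from that rectangle. *)
have [X [XP X1 Xsep]] := @separated_sequence R
  (fun i y => xs (level i) + 2 * l <= y /\ F y < l + ee (level i)) (4 * l + 4)
  ltac:(lra) ltac:(move=> i x; have [y h1 h2] := l_ub (ee (level i))
    (Num.max x (xs (level i) + 2 * l)) (ee0 _); exists y;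
    move: h1; rewrite ge_max => /andP[h1 h3]; done).
pose e i := ee (level i).
have H i : exists L : R, forall lam, L <= lam ->
    [/\ 4 <= lam, lam^-1 <= e i / 2, lam^-1 < du (level i) &
        2 * Num.sqrt lam + (W i (X i + 1) + 8 + 48 * (6 * l + 1)) <= lam * e i / 4].
  exact: large_parameter (ee0 _) (duP _).1.
have [L LP] := choice H; clear H.
(* The threshold [L i] involves the weight at [X i], so [t] and the vector are chosen after the
   centre. The larger set is [B i] itself: K is still unknown, but K <= i will hold for some i of
   the right level. *)
have H i : exists tx : R * E,
    [/\ l * L i <= tx.1, B (mm (level i)) tx.2 &
        ~ splits B (level i) i tx.1 (ee (level i) / (4 * l)) tx.2].
  by have [t [x [h1 h2 h3]]] := mmP (level i) i (l * L i); exists (t, x).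
have [tx txP] := choice H; clear H.
pose lam i := (tx i).1 / l; pose x i := (tx i).2.
have tE i : (tx i).1 = lam i * l by rewrite /lam divfK// gt_eqF.
have Llam i : L i <= lam i.
  by rewrite /lam ler_pdivlMr// mulrC; have [] := txP i.
have lam4 i : 4 <= lam i by have [] := LP i _ (Llam i).
have lame i : (lam i)^-1 <= e i / 2 by have [] := LP i _ (Llam i).
have lamd i : (lam i)^-1 < du (level i) by have [] := LP i _ (Llam i).
have lamV i : 2 * Num.sqrt (lam i) + (W i (X i + 1) + 8 + 48 * (6 * l + 1)) <= lam i * e i / 4.
  by have [] := LP i _ (Llam i).
have lam1 i : 1 <= lam i by apply: le_trans (lam4 i); lra.
have lamV4 i : (lam i)^-1 <= 4^-1.
  by rewrite lef_pV2 ?posrE//; apply: lt_le_trans (lam1 i).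
have Xsep2 i j : i != j -> 2 <= `|X i - X j| by move=> /Xsep; lra.
have SX i z : box l e lam X i z -> `|complex.Re z - X i| <= 4^-1.
  by move=> [h _]; apply: le_trans (lamV4 i).
(* A strip of ratio [a < 1] meets the boxes of finitely many levels only, so
   that a given estimate of [g] involves finitely many of the sets [B m]. *)
have Slvl (a : R) : 0 < a -> a < 1 -> exists n0, forall i z, box l e lam X i z ->
    closure (strip (fun t => a * F t)%R (fun t => a * G t)%R) z -> (level i <= n0)%N.
  move=> a0 a1; exists (Num.truncn (1 - a)^-1).+1 => i z Sz zcl.
  have ca : continuous (fun t => a * F t) by move=> t; apply: cvgM; [exact: cvg_cst|exact: cF].
  have zF := closure_strip_le ca zcl.
  have /andP[y1 _] := box_Im (lame i) Sz.
  have Fz : F (complex.Re z) <= l + 2 * e i.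
    have h := (duP (level i)).2 (complex.Re z) (X i) (le_lt_trans Sz.1 (lamd i)).
    have := (XP i).2; have := ler_norm (F (complex.Re z) - F (X i)); rewrite -/(e i) in h *; lra.
  have aF : a * F (complex.Re z) <= a * (l + 2 * e i) by rewrite ler_pM2l.
  have e_i : a * e i <= e i by rewrite ler_piMl ?ltW ?ee0.
  (* From l - 5 e <= Im z <= a F <= a (l + 2 e). As e = l / (16 (n + 1)), this reads 16 (n + 1) (1 -
     a) <= 7 and bounds the level n. *)
  have key : l * (1 - a) <= 7 * e i by lra.
  rewrite leqNgt; apply/negP; rewrite -(ltr_nat R) => h.
  have h1 : (1 - a)^-1 < (level i)%:R by apply: lt_trans h; exact: truncnS_gt.
  have s0 : 0 < 1 - a by lra.
  have nn : 0 < (level i).+1%:R :> R by rewrite ltr0n.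
  have h2 : 1 < (level i).+1%:R * (1 - a).
    by rewrite -ltr_pdivrMr// div1r -natr1; lra.
  move: key; rewrite /e /ee mulrA ler_pdivlMr ?mulr_gt0//.
  have := ltr_pM2l l0 1 ((level i).+1%:R * (1 - a)); rewrite h2 => h3.
  have := h3; lra.
pose u := box_family l e lam X.
have su k : smooth_family (box l e lam X) lam k u.
  exact: (@box_smooth R l e lam X l0 k (fun i => ee0 (level i))
    (fun i => eel (level i)) lam4 lame).
have spu : supported (box l e lam X) u by exact: box_supported.
pose g := gluing X (fun i => (damping X lam W i)%:C *: x i) u.
have KWg : KW W F G g.
  apply: (@gluing_KW _ _ hE X (box l e lam X) x lam lam1 X1 Xsep2 SX
    (fun i => @closed_box R l e lam X i) W F G level (fun n => B (mm n)) hW) => //.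
  - by move=> n; have [hb _ _] := hB; have [_] := hb (mm n).
  - by move=> i; have [] := txP i.
have [f KWf fg] := hsurj _ KWg.
have [_ _ hbd] := hB.
(* The whole real axis lies in the strip of ratio 1/2, so [N] is found without reference to any
   centre; only then is the level fixed. *)
have [N hN] : exists N, forall z : Cplane R, complex.Im z = 0 -> B N (f z).
  have bd : tvs_bounded (region_values f [set z | complex.Im z = 0]).
    apply: (@region_bounded _ _ hE W F G f hW KWf F0 (fun t => ltW (G0 t)) 2^-1) => //.
    - lra.
    - move=> z /= z0; have h1 := G0 (complex.Re z).
      have h2 : 0 < F (complex.Re z) by apply: lt_le_trans FI0 _; case/andP: (FB (complex.Re z)).
      by rewrite /strip /= z0; apply/andP; split; lra.
    - move=> v [z1 z2] t s v1 /= z0 zt /andP[s0 st]; move: zt; rewrite z0.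
      by case: v1 => -> /=; lra.
  have [N NB] := hbd _ bd; exists N => z z0; apply: NB; exists z => //; by constructor 1.
have eN0 := ee0 N; have eNl := eel N.
pose Om := [set z : Cplane R | xs N <= complex.Re z /\ 0 <= complex.Im z <= l - 2 * ee N].
(* To the right of [xs N] one has F > l - e, so this ratio times F exceeds the height l - 2 e of
   [Om]. *)
have a0 : 0 < (l - 2 * ee N) / (l - ee N) by rewrite divr_gt0//; lra.
have a1 : (l - 2 * ee N) / (l - ee N) < 1 by rewrite ltr_pdivrMr ?mul1r; lra.
have Oma : Om `<=` strip (fun t => (l - 2 * ee N) / (l - ee N) * F t)
    (fun t => (l - 2 * ee N) / (l - ee N) * G t).
  move=> z [zx /andP[y0 y1]]; apply/andP; split.
    by apply: lt_le_trans y0; rewrite oppr_lt0 mulr_gt0.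
  apply: le_lt_trans y1 _.
  have d0 : l - ee N != 0 by rewrite gt_eqF//; lra.
  have := ltr_pM2l a0 (l - ee N) (F (complex.Re z)).
  by rewrite (divfK d0) (xsP _ _ zx) => ->.
have Omcvx (v z : Cplane R) (t s : R) : v = 1 \/ v = 'i%C ->
    Om z -> Om (z + t%:C * v) -> 0 <= s <= t -> Om (z + s%:C * v).
  move=> v1 Oz Ozt /andP[s0 st]; move: Oz Ozt.
  case: z => z1 z2 [/= c1 /andP[c3 c4]] [/= b1 /andP[b3 b4]].
  case: v1 b1 b3 b4 => -> /=; rewrite !mulr0 !mul0r !mulr1 ?subr0 ?addr0 ?add0r.
    by move=> b1 b3 b4; split=> /=; [|apply/andP; split]; lra.
  by move=> b1 b3 b4; split=> /=; [|apply/andP; split]; lra.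
have [K hK] := hbd _ (region_bounded hE hW KWf F0 (fun t => ltW (G0 t)) a0 a1 Oma Omcvx).
have [i Ki iN] := level_infinite N K.
have eE : ee N = e i by rewrite /e iN.
have [xN _] := XP i; rewrite iN in xN.
have D_Om z : rect (X i - 2 * l) (4 * l) (l - 2 * e i) z -> Om z.
  by move=> [/andP[h1 h2] h3]; rewrite /Om /= eE; split=> //; lra.
have Bi y : region_values f Om y -> B i y by move=> /hK; exact: fundamental_le.
have [_ _] := txP i; apply; rewrite -/(x i) tE iN.
have -> : ee N / (4 * l) = e i / (4 * l) by rewrite eE.
have feq z : rect (X i - 2 * l) (4 * l) (l - 2 * e i) z ->
    dx f z + 'i%C *: dy f z = (2 * box_fun l (e i) (lam i) (X i) z : R[i]) *:
      ((expR (- (Num.sqrt (lam i) + W i (X i + 1))))%:C *: x i).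
  move=> Dz; have Sz := region_strip F0 (fun t => ltW (G0 t)) a1 Oma (D_Om z Dz).
  have := fg z Sz; rewrite /dbar => fgz.
  have -> : dx f z + 'i%C *: dy f z = (2 : R[i]) *: g z.
    rewrite -fgz scalerA -(rmorph_nat (real_complex R) 2) -rmorphM/=.
    by rewrite divff ?scale1r// pnatr_eq0.
  rewrite -scalerA; congr (_ *: _); rewrite -/(damping X lam W i).
  have [Bz|nBz] := pselect (box l e lam X i z).
    rewrite /g (@gluingE _ _ _ _ Xsep2 u z i)//.
    by apply: le_lt_trans (SX _ _ Bz) _; lra.
  rewrite (_ : box_fun _ _ _ _ _ = u i z)// spu// scale0r.
  have [//|[j [Sj _]]] := gluing_cases X (fun i => (damping X lam W i)%:C *: x i) z spu.
  (* Another box meeting the rectangle would put two centres within 2 l + 1/4 of each other. *)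
  have ij : j != i by apply/eqP => ji; rewrite ji in Sj.
  have := Xsep _ _ ij; case: Dz => /andP[h1 h2] _; have := SX _ _ Sj.
  have -> : X j - X i = (complex.Re z - X i) - (complex.Re z - X j) by lra.
  have := ler_normB (complex.Re z - X i) (complex.Re z - X j).
  have : `|complex.Re z - X i| <= 2 * l by rewrite ler_norml; apply/andP; split; lra.
  by move=> h3 h4 h5 h6; exfalso; lra.
have fBi z (Dz : rect (X i - 2 * l) (4 * l) (l - 2 * e i) z) :
    [/\ B i (f z), B i (dx f z) & B i (dy f z)].
  by split; apply: Bi; exists z; [exact: D_Om|constructor 1|exact: D_Om|constructor 2
    |exact: D_Om|constructor 3].
have fT1 : taylor2 (B i) (X i - 2 * l) (4 * l) (l - 2 * e i) f 1 (dx f).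
  move=> z t Dz t0 Dzt; apply: Bi; exists z; first exact: D_Om.
  by constructor 4; exists t => //; left; split=> //; exact: D_Om.
have fTi : taylor2 (B i) (X i - 2 * l) (4 * l) (l - 2 * e i) f 'i%C (dy f).
  move=> z t Dz t0 Dzt; apply: Bi; exists z; first exact: D_Om.
  by constructor 4; exists t => //; right; split=> //; exact: D_Om.
have [yn [yk [xE ynB ykB]]] := @local_split R E (B N) (B i) (@fundamental_cvx _ _ _ hB N)
  (@fundamental_cvx _ _ _ hB i) l (e i) (lam i) (X i) (W i (X i + 1)) (x i) f (dx f) (dy f)
  fBi (fun z _ z0 => hN z z0) fT1 fTi feq l0 (ee0 _) (eel _) (lam4 i) (lame i) (lamV i).
exists yn, yk; split=> //.
rewrite (_ : e i / (4 * l) * (lam i * l) = lam i * e i / 4)//.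
by field; rewrite gt_eqF.
Qed.
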